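(* Let $d\ge 1$. 1. If $X$ and $Z$ are random variables on $E_{d+1}$ and if there exists $c>0$ such that $T_c(X)(f)=T_c(Z)(f)$ for all $f\in U_{d+1}$, then $X\sim Z$. 2. Let $X$ be a random variable on $E_{d+1}$ and $c>0$. If $k$ is a non-negative integer and $H=-\left(\frac{\partial}{\partial f_0}+\cdots+\frac{\partial}{\partial f_d}\right)$, then on $U_{d+1}$ $$H^kT_c(X)=(c)_k\,T_{c+k}(X).$$ 3. If $(a_0,\ldots,a_d)\in U_{d+1}$, $a=a_0+\cdots+a_d$ and $X\sim\mathcal{D}(a_0,\ldots,a_d)$, then for all $f\in U_{d+1}$ $$T_a(X)(f)=f_0^{-a_0}\cdots f_d^{-a_d}.$$ 4. Let $r\geq 1$ and $b_0,\ldots,b_r>0$. Suppose that $X_0,\ldots,X_r,Y$ are independent random variables such that $X_i\in E_{d+1}$ for $i=0,\ldots,r$ and $Y=(Y_0,\ldots,Y_r)\in E_{r+1}$ has Dirichlet distribution $\mathcal{D}(b_0,\ldots,b_r)$. Then for $b=b_0+\cdots+b_r$ and $Z=X_0Y_0+\cdots+X_rY_r$ we have for all $f\in U_{d+1}$ $$T_b(Z)(f)=T_{b_0}(X_0)(f)\cdots T_{b_r}(X_r)(f).$$ In particular, if $X_0,X_1$ (valued in $E_{d+1}$) and the real random variable $Y\sim\beta(b_1,b_0)$ are independent, then $$T_{b_0+b_1}\big((1-Y)X_0+YX_1\big)=T_{b_0}(X_0)\,T_{b_1}(X_1).$$ 5. Let $X=(X_0,\ldots,X_d)$ be a random variable on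 $E_{d+1}$, $c>0$ and $0\le k\le d$. Then $$\lim_{f_0\to\infty}T_c(X)(f_0,\ldots,f_0,1,1,\ldots,1)=\Pr(X_0=X_1=\cdots=X_k=0),$$ where on the left the first $k+1$ coordinates (those of index $0,\ldots,k$) equal $f_0$ and the remaining ones equal $1$.
   Context: $E_{d+1}$ is the set of $\lambda=(\lambda_0,\ldots,\lambda_d)\in\mathbb{R}^{d+1}$ with $\lambda_i\ge0$ for all $i$ and $\lambda_0+\cdots+\lambda_d=1$. $U_{d+1}=\{f=(f_0,\ldots,f_d)\in\mathbb{R}^{d+1}: f_0>0,\ldots,f_d>0\}$ and $\langle f,x\rangle=\sum_{i=0}^df_ix_i$. For a random variable $X$ valued in $E_{d+1}$ and $c>0$, the $T_c$ transform of $X$ is the function on $U_{d+1}$ given by $T_c(X)(f)=\mathbb{E}(\langle f,X\rangle^{-c})$. $(c)_n$ is the Pochhammer symbol: $(c)_0=1$, $(c)_{n+1}=(c)_n(c+n)$. The notation $U\sim V$ between random variables means equality in distribution, and $U\sim\mu$ means that $U$ has law $\mu$. For $p,q>0$, $\beta(p,q)$ is the law on $(0,1)$ with density $\frac{\Gamma(p+q)}{\Gamma(p)\Gamma(q)}x^{p-1}(1-x)^{q-1}$. For $a_0,\ldots,a_d>0$, the Dirichlet distribution $\mathcal{D}(a_0,\ldots,a_d)$ is the law on $E_{d+1}$ of $X=(X_0,\ldots,X_d)$ with $X_0=1-X_1-\cdots-X_d$ such that $(X_1,\ldots,X_d)$ has density $\frac{\Gamma(a_0+\cdots+a_d)}{\Gamma(a_0)\cdots\Gamma(a_d)}(1-x_1-\cdots-x_d)^{a_0-1}x_1^{a_1-1}\cdots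 x_d^{a_d-1}$ on the set where $x_1,\ldots,x_d>0$ and $x_1+\cdots+x_d<1$. *)

(* Defs.v *)
From HB Require Import structures.
From mathcomp Require Import all_boot all_order all_algebra.
From mathcomp Require Import all_classical all_reals all_analysis.

Set Implicit Arguments.
Unset Strict Implicit.
Unset Printing Implicit Defensive.

Import Order.TTheory GRing.Theory Num.Theory.
Import numFieldNormedType.Exports.

Local Open Scope classical_set_scope.
Local Open Scope ring_scope.

Section lebesgue_tuple.
Context {R : realType}.

(* Lebesgue measure on R^n, realised on n-tuples (which carry the product
   sigma-algebra) by transporting lebesgue_measure \x (Lebesgue measure on R^n)
   along (x, t) |-> x :: t. *)
Definition pair_cons n (z : measurableTypeR R * n.-tuple R) : n.+1.-tuple R :=
  [tuple of (z.1 : R) :: z.2].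

Lemma measurable_pair_cons n :
  measurable_fun [set: measurableTypeR R * n.-tuple R] (@pair_cons n).
Proof. by apply: measurable_cons => //; exact: measurable_fst. Qed.

Section step.
Variables (n : nat) (m : {sigma_finite_measure set (n.-tuple R) -> \bar R}).

Definition lebesgue_tupleS : set (n.+1.-tuple R) -> \bar R :=
  pushforward (lebesgue_measure \x m)%E (@pair_cons n).

Let m0 : lebesgue_tupleS set0 = 0%E.
Proof. by rewrite /lebesgue_tupleS /pushforward preimage_set0 measure0. Qed.

Let m_ge0 A : (0 <= lebesgue_tupleS A)%E.
Proof. exact: (measure_ge0 (lebesgue_measure \x m)%E). Qed.

Let m_sigma_additive : semi_sigma_additive lebesgue_tupleS.
Proof.
move=> F mF tF mUF; rewrite /lebesgue_tupleS /pushforward preimage_bigcup.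
have mpF A : measurable A -> measurable (@pair_cons n @^-1` A).
  by move=> mA; rewrite -[X in measurable X]setTI; exact: measurable_pair_cons.
apply: measure_semi_sigma_additive => [i||]; first exact: mpF.
- apply/trivIsetP => /= i j _ _ ij; rewrite -preimage_setI.
  by move/trivIsetP : tF => /(_ _ _ _ _ ij) ->//; rewrite preimage_set0.
- by rewrite -preimage_bigcup; exact: mpF.
Qed.

HB.instance Definition _ :=
  isMeasure.Build _ _ _ lebesgue_tupleS m0 m_ge0 m_sigma_additive.

Let lebesgue_tupleS_sigma_finite : sigma_finite setT lebesgue_tupleS.
Proof.
have /sigma_finiteP[F [FT ndF Foo]] := sigma_finiteT (@lebesgue_measure R).
have /sigma_finiteP[G [GT ndG Goo]] := sigma_finiteT m.
exists (fun k => [set t | F k (thead t) /\ G k [tuple of behead t]]).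
  apply/esym; rewrite -subTset => t _.
  have [i _ Fi] : (\bigcup_i F i) (thead t) by rewrite -FT.
  have [j _ Gj] : (\bigcup_i G i) [tuple of behead t] by rewrite -GT.
  exists (maxn i j) => //; split.
  - by move: Fi; exact/subsetPset/ndF/leq_maxl.
  - by move: Gj; exact/subsetPset/ndG/leq_maxr.
move=> k; have [mF Fk] := Foo k; have [mG Gk] := Goo k; split.
  apply: measurableI; rewrite -[X in measurable X]setTI.
    exact: (@measurable_tnth _ R n.+1 ord0).
  exact: measurable_behead.
rewrite /lebesgue_tupleS /pushforward [X in (_ \x _)%E X](_ : _ = F k `*` G k).
  by rewrite product_measure1E// lte_mul_pinfty// ge0_fin_numE.
apply/seteqP; split => -[x t] /=; rewrite theadE (_ : [tuple of _] = t)//;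
  exact: val_inj.
Qed.

HB.instance Definition _ :=
  Measure_isSigmaFinite.Build _ _ _ lebesgue_tupleS lebesgue_tupleS_sigma_finite.
End step.

Fixpoint lebesgue_tuple n : {sigma_finite_measure set (n.-tuple R) -> \bar R} :=
  if n is n'.+1 then lebesgue_tupleS (lebesgue_tuple n')
  else dirac [tuple].

Lemma lebesgue_tuple_box n (A : 'I_n -> set R) :
  (forall i, measurable (A i)) ->
  lebesgue_tuple n [set t | forall i, A i (tnth t i)] =
  (\prod_(i < n) lebesgue_measure (A i))%E.
Proof.
elim: n A => [|n IH] A mA.
  by rewrite big_ord0 /= diracE mem_set// => -[].
rewrite big_ord_recl -IH//= -product_measure1E//; last first.
  rewrite [X in measurable X](_ : _ =
      \bigcap_(i in setT) ((fun t : n.-tuple R => tnth t i) @^-1` A (lift ord0 i))).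
    apply: fin_bigcap_measurable => // i _; rewrite -[X in measurable X]setTI.
    exact: measurable_tnth.
  by apply/seteqP; split=> [t h i _|t h i]; exact: h.
  exact: mA.
rewrite /lebesgue_tupleS /pushforward; congr (_ _).
apply/seteqP; split => -[x t] /= h.
  by split => [|i]; [exact: (h ord0)|have := h (lift ord0 i); rewrite tnthS].
move=> i; case: (unliftP ord0 i) => [j ->|->].
  by rewrite tnthS; exact: h.2.
by have [] := h.
Qed.

End lebesgue_tuple.

Section simplex.
Context {R : realType}.

(* simplex d.+1 is E_{d+1} *)
Definition simplex n : set (n.-tuple R) :=
  [set x | (forall i, 0 <= tnth x i) /\ \sum_(i < n) tnth x i = 1].

(* orthant d.+1 is U_{d+1} *)
Definition orthant n : set 'rV[R]_n := [set f | forall i, 0 < f ord0 i].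

Definition pairing n (f : 'rV[R]_n) (x : n.-tuple R) : R :=
  \sum_(i < n) f ord0 i * tnth x i.

Fixpoint pochhammer (c : R) (n : nat) : R :=
  if n is n'.+1 then pochhammer c n' * (c + n'%:R) else 1.

(* the operator H *)
Definition neg_sum_partial n (F : 'rV[R]_n -> R) (f : 'rV[R]_n) : R :=
  - \sum_(i < n) 'D_(delta_mx ord0 i) F f.

(* For f in the orthant and X valued in the simplex, the expectation is that of
   a bounded random variable, so that fine discards nothing. *)
Definition T_transform d (T : measurableType d) (P : probability T R) (c : R)
    n (X : T -> n.-tuple R) (f : 'rV[R]_n) : R :=
  fine 'E_P[fun w => pairing f (X w) `^ (- c)].

End simplex.

Arguments simplex {R} n _.
Arguments orthant {R} n _.
Arguments neg_sum_partial {R n} F f.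

Section laws.
Context {R : realType}.

Definition has_law d d' (T : measurableType d) (V : measurableType d')
    (P : probability T R) (X : {RV P >-> V}) (mu : set V -> \bar R) : Prop :=
  forall A, measurable A -> distribution P X A = mu A.

Definition eq_law d1 d2 d' (T1 : measurableType d1) (T2 : measurableType d2)
    (V : measurableType d') (P1 : probability T1 R) (P2 : probability T2 R)
    (X1 : {RV P1 >-> V}) (X2 : {RV P2 >-> V}) : Prop :=
  has_law X1 (distribution P2 X2).

Definition Gamma (p : R) : R :=
  \int[lebesgue_measure]_(x in `]0, +oo[) (x `^ (p - 1) * expR (- x)).

Definition beta_pdf (p q x : R) : R :=
  Gamma (p + q) / (Gamma p * Gamma q) * x `^ (p - 1) * (1 - x) `^ (q - 1).

(* The library's beta_prob only allows parameters in nat. *)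
Definition beta_law (p q : R) (A : set R) : \bar R :=
  (\int[lebesgue_measure]_(x in `]0%R, 1%R[ `&` A) (beta_pdf p q x)%:E)%E.

Definition open_simplex n : set (n.-tuple R) :=
  [set x | (forall i, 0 < tnth x i) /\ \sum_(i < n) tnth x i < 1].

Definition dirichlet_pdf n (a : 'rV[R]_n.+1) (x : n.-tuple R) : R :=
  Gamma (\sum_i a ord0 i) / \prod_i Gamma (a ord0 i)
  * (1 - \sum_(j < n) tnth x j) `^ (a ord0 ord0 - 1)
  * \prod_(j < n) tnth x j `^ (a ord0 (lift ord0 j) - 1).

(* (x_1, ..., x_n) |-> (1 - x_1 - ... - x_n, x_1, ..., x_n) *)
Definition complete_tuple n (x : n.-tuple R) : n.+1.-tuple R :=
  [tuple of (1 - \sum_(j < n) tnth x j) :: x].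

Definition dirichlet n (a : 'rV[R]_n.+1) (A : set (n.+1.-tuple R)) : \bar R :=
  (\int[lebesgue_tuple n]_(x in @open_simplex n `&` @complete_tuple n @^-1` A)
     (dirichlet_pdf a x)%:E)%E.

(* Mutual independence of a finite family of sigma-algebras; random variables
   with values in possibly different spaces are independent when the
   sigma-algebras g_sigma_algebra_preimage they generate are. *)
Definition mutually_independent d (T : measurableType d) (P : probability T R)
    (I : finType) (S : I -> set (set T)) : Prop :=
  forall (J : {set I}) (A : I -> set T), (forall i, i \in J -> S i (A i)) ->
  P (\bigcap_(i in [set` J]) A i) = (\prod_(i in J) P (A i))%E.

End laws.

(* Main.v *)
(* Part (3) rests on Gamma(c) <f,x>^-c = int_0^oo t^(c-1) e^(-t <f,x>) dt.
   Substituting it in the Dirichlet integral and putting y = t x turns the integral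
   over the simplex and t into a product of Gamma integrals, which gives (3).
   Conditioning on the X_i, the variable <f,Z> of (4) is the pairing of Y with the
   vector of the <f,X_i>, so (3) yields the product of the <f,X_i>^-b_i, whose
   expectation factors by independence; the beta case is the Dirichlet case r = 1.
   (2) is differentiation under the integral sign and (5) is dominated convergence.
   For (1), (2) gives T_(c+k)(X) = T_(c+k)(Z) for all k; evaluated at f = 1 + m/k it
   tends to E e^-<m,X>. Hence X and Z have the same expectations of polynomials in
   the e^-x_i, and suitable products of such polynomials converge boundedly to the
   indicators of the boxes { x_i > b_i for all i }, which determine the law. *)
Require Import Defs.
From mathcomp Require Import all_boot all_order all_algebra.
From mathcomp Require Import all_classical all_reals all_analysis.
From mathcomp Require Import measurable_realfun ring.

Set Implicit Arguments.
Unset Strict Implicit.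
Unset Printing Implicit Defensive.

Import Order.TTheory GRing.Theory Num.Theory.
Import numFieldNormedType.Exports.

Local Open Scope classical_set_scope.
Local Open Scope ring_scope.

(** * Integrals determined by a law *)

(** Laws enter as set functions: [has_law] compares values on measurable sets, and independence is a
    statement about events. Each passage to integrals therefore goes through simple functions, or
    through the uniqueness of a finite measure with prescribed values on boxes. The Gamma integrals
    stay in the extended reals, and the Dirichlet identity is stated as an equality of products
    rather than of quotients, so that it is true whether or not they are finite. Finiteness is
    extracted only once a random variable with the Dirichlet law is at hand. In (1) the transform at
    a fixed exponent is not multiplicative in f. Raising the exponent cures this: since the
    coordinates of X sum to 1, the point 1 of the orthant pairs to 1 with X, and expanding around it
    at scale 1/k produces a Laplace transform. *)

Section transfer.
Local Open Scope ereal_scope.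
Context {R : realType} d (V : measurableType d).
Import HBNNSimple.

(** The right-hand side sees [mu], [phi] and [p] only through the set function sending A to the
    integral of [p] over the preimage of A: the approximating simple functions are built from [g]
    alone. *)
Lemma ge0_integral_comp_density d1 (U : measurableType d1)
    (mu : {measure set U -> \bar R}) (phi : U -> V) (p : U -> R)
    (g : V -> \bar R) (mg : measurable_fun [set: V] g) :
  measurable_fun [set: U] phi -> measurable_fun [set: U] p ->
  (forall x, 0 <= p x)%R -> (forall v, 0 <= g v) ->
  \int[mu]_x (g (phi x) * (p x)%:E) =
  limn (fun n => \sum_(k \in range (nnsfun_approx measurableT mg n))
    k%:E * \int[mu]_(x in phi @^-1`
                     (nnsfun_approx measurableT mg n @^-1` [set k])) (p x)%:E).
Proof.
move=> mphi mp p0 g0; set f_ := nnsfun_approx measurableT mg.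
have mphiA (A : set V) : measurable A -> measurable (phi @^-1` A).
  by move=> mA; rewrite -[X in measurable X]setTI; exact: mphi.
transitivity (limn (fun n => \int[mu]_x ((f_ n (phi x))%:E * (p x)%:E))).
  rewrite -monotone_convergence//.
  - apply: eq_integral => x _; apply/esym/cvg_lim => //.
    by apply: cvgeZr => //; exact: cvg_nnsfun_approx.
  - move=> n; apply/measurable_EFinP; apply: measurable_funM => //.
    exact: measurableT_comp.
  - by move=> n x _; rewrite mule_ge0// lee_fin.
  - move=> x _ m n mn; rewrite lee_wpmul2r// lee_fin//.
    exact/lefP/nd_nnsfun_approx.
congr (limn _); apply/funext => n.
have f_ind k x : 0 <= (k * \1_(f_ n @^-1` [set k]) (phi x))%:E.
  by rewrite EFinM nnfun_muleindic_ge0.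
transitivity (\int[mu]_x (\sum_(k \in range (f_ n))
   (k * \1_(f_ n @^-1` [set k]) (phi x))%:E * (p x)%:E)).
  apply: eq_integral => x _.
  by rewrite -ge0_mule_fsuml// fimfunE fsumEFin.
have mind k : measurable_fun [set: U]
    (fun x => (k * \1_(f_ n @^-1` [set k]) (phi x))%R).
  by apply: measurable_funM => //; apply: measurableT_comp.
rewrite ge0_integral_fsum//; last 2 first.
- by move=> k; apply/measurable_EFinP; apply: measurable_funM.
- by move=> k x _; rewrite mule_ge0// lee_fin.
apply: eq_fsbigr => k /[!inE] -[v _ <-].
under eq_integral do rewrite EFinM -muleA.
rewrite ge0_integralZl//; last 3 first.
- by apply/measurable_EFinP; apply: measurable_funM => //; exact: measurableT_comp.
- by move=> x _; rewrite mule_ge0// lee_fin.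
- by rewrite lee_fin.
congr *%E; rewrite [RHS]integral_mkcond; apply: eq_integral => x _.
rewrite patchE indicE; have [xk|xk] := boolP (x \in _).
  by rewrite mem_set ?mul1e//; move: xk; rewrite inE.
by rewrite memNset ?mul0e//; move: xk; rewrite notin_setE.
Qed.

(** A change of variables for image laws known only by their values on sets. It serves both for laws
    given by densities and, with the remaining factors of a product as density, for independence. *)
Lemma ge0_integral_transfer d1 d2 (U1 : measurableType d1)
    (U2 : measurableType d2) (mu1 : {measure set U1 -> \bar R})
    (mu2 : {measure set U2 -> \bar R}) (phi1 : U1 -> V) (phi2 : U2 -> V)
    (p1 : U1 -> R) (p2 : U2 -> R) (g : V -> \bar R) :
  measurable_fun [set: U1] phi1 -> measurable_fun [set: U2] phi2 ->
  measurable_fun [set: U1] p1 -> measurable_fun [set: U2] p2 ->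
  (forall x, 0 <= p1 x)%R -> (forall x, 0 <= p2 x)%R ->
  (forall A, measurable A -> \int[mu1]_(x in phi1 @^-1` A) (p1 x)%:E =
                             \int[mu2]_(x in phi2 @^-1` A) (p2 x)%:E) ->
  measurable_fun [set: V] g -> (forall v, 0 <= g v) ->
  \int[mu1]_x (g (phi1 x) * (p1 x)%:E) = \int[mu2]_x (g (phi2 x) * (p2 x)%:E).
Proof.
move=> mphi1 mphi2 mp1 mp2 p10 p20 p12 mg g0.
rewrite !ge0_integral_comp_density//; congr (limn _); apply/funext => n.
by apply: eq_fsbigr => k _; rewrite p12.
Qed.

End transfer.

(** Boxes with sides in [G] are stable under intersection and generate the product sigma-algebra.
    Finite total mass lets the constant sequence [setT] serve as the exhaustion. *)
Lemma measure_tuple_unique {R : realType} d (T : measurableType d) n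
    (G : set (set T)) (m1 m2 : {measure set (n.-tuple T) -> \bar R}) :
  @measurable d T = <<s G >> -> setI_closed G -> G setT ->
  (m1 setT < +oo)%E ->
  (forall A : 'I_n -> set T, (forall i, G (A i)) ->
    m1 [set t | forall i, A i (tnth t i)] =
    m2 [set t | forall i, A i (tnth t i)]) ->
  forall E, measurable E -> m1 E = m2 E.
Proof.
move=> GE GI GT m1oo m12.
pose box (A : 'I_n -> set T) := [set t : n.-tuple T | forall i, A i (tnth t i)].
pose C := [set E | exists A, (forall i, G (A i)) /\ E = box A].
have boxT : box (fun=> setT) = setT by apply/seteqP; split.
apply: (measure_unique C (fun=> setT)) => //.
- apply/seteqP; split; last first.
    apply: smallest_sub; first exact: sigma_algebra_measurable.
    move=> _ [A [GA ->]].
    rewrite (_ : box A =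
        \bigcap_(i in setT) ((fun t : n.-tuple T => tnth t i) @^-1` A i)).
      apply: fin_bigcap_measurable => // i _; rewrite -[X in measurable X]setTI.
      apply: measurable_tnth => //; rewrite GE; exact: sub_sigma_algebra.
    by apply/seteqP; split=> t h i; [move=> _|]; exact: h.
  apply: smallest_sub; first exact: smallest_sigma_algebra.
  rewrite -bigcup_seq => _ [i _ [B mB <-]]; rewrite setTI.
  suff : measurable `<=` image_set_system setT (fun t : n.-tuple T => tnth t i)
      <<s C >>.
    by move=> /(_ B mB); rewrite /image_set_system/= setTI.
  rewrite GE; apply: smallest_sub.
    exact/sigma_algebra_image/smallest_sigma_algebra.
  move=> A GA; rewrite /image_set_system/= setTI; apply: sub_sigma_algebra.
  (* A cylinder over coordinate i is a box because [G] contains [setT]. *)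
  exists (fun j => if j == i then A else setT); split; first by move=> j; case: ifP.
  apply/seteqP; split=> [t At j|t /(_ i)]; last by rewrite eqxx.
  by case: eqP => // ->.
- move=> _ _ [A [GA ->]] [B [GB ->]]; exists (fun i => A i `&` B i).
  split; first by move=> i; exact: GI.
  by apply/seteqP; split=> t => [[hA hB] i|h]; split => //; move=> i; have [] := h i.
- by move=> i; exists (fun=> setT).
- by apply/seteqP; split => // t _; exists 0%N.
- by move=> _ [A [GA ->]]; exact: m12.
Qed.

(** * Translations and dilations of Lebesgue measure on the line *)

Section lebesgue_affine.
Local Open Scope ereal_scope.
Context {R : realType}.
Local Notation mu := (@lebesgue_measure R).

Lemma ge0_integral_shift (s : R) (f : R -> \bar R) :
  measurable_fun [set: R] f -> (forall x, 0 <= f x) ->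
  \int[mu]_x f (x - s)%R = \int[mu]_x f x.
Proof.
move=> mf f0; pose phi (x : measurableTypeR R) : measurableTypeR R := (x - s)%R.
have mphi : measurable_fun [set: measurableTypeR R] phi by exact: measurable_funB.
rewrite -[LHS](@ge0_integral_pushforward _ _ _ _ _ phi mphi mu setT)//.
apply: eq_measure_integral => A mA _; apply/esym/lebesgue_measure_unique => //.
move=> _ [[a b]] _ <-; rewrite /= /pushforward.
rewrite (_ : phi @^-1` `]a, b] = `](a + s)%R, (b + s)%R]%classic); last first.
  by apply/seteqP; split => x /=; rewrite !in_itv/= ltrBrDr lerBlDr.
rewrite !lebesgue_measure_itv/= !lte_fin ltrD2r.
by case: ifPn => // _; rewrite -!EFinB; congr EFin; rewrite opprD addrACA subrr addr0.
Qed.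

Lemma ge0_integral_dilate (c : R) (f : R -> \bar R) : (0 < c)%R ->
  measurable_fun [set: R] f -> (forall x, 0 <= f x) ->
  \int[mu]_x f (c * x)%R = c^-1%:E * \int[mu]_x f x.
Proof.
move=> c0 mf f0; pose phi (x : measurableTypeR R) : measurableTypeR R := (c * x)%R.
have mphi : measurable_fun [set: measurableTypeR R] phi by exact: measurable_funM.
rewrite -[LHS](@ge0_integral_pushforward _ _ _ _ _ phi mphi mu setT)//.
have ci0 : (0 <= c^-1)%R by rewrite invr_ge0 ltW.
rewrite -[in RHS](@ge0_integral_mscale _ _ _ mu setT measurableT (NngNum ci0))//.
apply: eq_measure_integral => A mA _.
have cc : (c * c^-1 = 1)%R by rewrite divff// gt_eqF.
(* Uniqueness characterises Lebesgue measure itself, so the scaling factor is moved onto the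
   pushforward before it is invoked. *)
suff : mu A = mscale (NngNum (ltW c0)) (pushforward mu phi) A.
  move=> /(_ mphi) muE; rewrite /= /mscale/= muE /mscale/=.
  by rewrite muleA -EFinM mulrC cc mul1e.
move=> ?; apply: lebesgue_measure_unique => // _ [[a b]] _ <-.
change (mu `]a, b] = c%:E * mu (phi @^-1` `]a, b])).
rewrite (_ : phi @^-1` `]a, b] = `](c^-1 * a)%R, (c^-1 * b)%R]%classic); last first.
  apply/seteqP; split => x /=; rewrite !in_itv/= /phi.
    rewrite -(ltr_pM2l (_ : 0 < c^-1)%R) ?invr_gt0//.
    by rewrite -(ler_pM2l (_ : 0 < c^-1)%R) ?invr_gt0// mulKf// gt_eqF.
  by rewrite -(ltr_pM2l c0) -(ler_pM2l c0) !mulVKf// gt_eqF.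
rewrite !lebesgue_measure_itv/= !lte_fin ltr_pM2l ?invr_gt0//.
case: ifPn => // _; last by rewrite mule0.
by rewrite -!EFinB -EFinM -mulrBr mulrA cc mul1r.
Qed.

End lebesgue_affine.

(** * Lebesgue integrals over tuples *)

Section lebesgue_tuple_integral.
Local Open Scope ereal_scope.
Context {R : realType}.
Local Notation mu := (@lebesgue_measure R).

Lemma ge0_integral_lebesgue_tupleS n (F : n.+1.-tuple R -> \bar R) :
  measurable_fun [set: n.+1.-tuple R] F -> (forall t, 0 <= F t) ->
  \int[lebesgue_tuple n.+1]_t F t =
  \int[mu]_x \int[lebesgue_tuple n]_t F (pair_cons (x, t)).
Proof.
move=> mF F0; have mpc := @measurable_pair_cons R n.
transitivity (\int[(mu \x lebesgue_tuple n)%E]_z F (pair_cons z)).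
  by rewrite -[RHS](@ge0_integral_pushforward _ _ _ _ _ _ mpc _ setT F).
by rewrite fubini_tonelli1//; exact: measurableT_comp.
Qed.

Lemma measurable_map_tuple n (f : R -> R) :
  measurable_fun [set: R] f ->
  measurable_fun [set: n.-tuple R] (fun t : n.-tuple R => [tuple of map f t]).
Proof.
move=> mf; apply/measurable_fun_tnthP => i.
rewrite (_ : _ \o _ = f \o (fun t : n.-tuple R => tnth t i)); last first.
  by apply/funext => t /=; rewrite tnth_map.
by apply: measurableT_comp => //; exact: measurable_tnth.
Qed.

Lemma ge0_integral_tuple_dilate n (c : R) (F : n.-tuple R -> \bar R) :
  (0 < c)%R -> measurable_fun [set: n.-tuple R] F -> (forall t, 0 <= F t) ->
  \int[lebesgue_tuple n]_t F [tuple of map ( *%R c) t] =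
  ((c^-1) ^+ n)%:E * \int[lebesgue_tuple n]_t F t.
Proof.
move=> c0; elim: n F => [|n IH] F mF F0.
  rewrite expr0 mul1e; apply: eq_integral => t _; congr F.
  by rewrite (tuple0 t); exact: val_inj.
have mc m : measurable_fun setT (fun t : m.-tuple R => [tuple of map ( *%R c) t]).
  by apply: measurable_map_tuple; exact: mulrl_measurable.
rewrite !ge0_integral_lebesgue_tupleS//; last first.
  by apply: (measurableT_comp mF); exact: mc.
pose H x := \int[lebesgue_tuple n]_t F (pair_cons (x, t)).
have mFp : measurable_fun setT (F \o @pair_cons R n).
  by apply: measurableT_comp => //; exact: measurable_pair_cons.
have mH : measurable_fun setT H.
  exact: (measurable_fun_fubini_tonelli_F (m2 := lebesgue_tuple n) _ mFp (fun=> F0 _)).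
have H0 x : 0 <= H x by exact: integral_ge0.
transitivity (\int[mu]_x (((c^-1) ^+ n)%:E * H (c * x)%R)).
  apply: eq_integral => x _.
  rewrite -[RHS]IH//; last exact: (measurableT_comp mFp).
  by apply: eq_integral => t _; congr F; exact: val_inj.
have mHc : measurable_fun [set: measurableTypeR R] (fun x => H (c * x)%R).
  by apply: (measurableT_comp mH); exact: mulrl_measurable.
have cn0 : 0 <= ((c^-1) ^+ n)%:E by rewrite lee_fin exprn_ge0// invr_ge0 ltW.
rewrite (ge0_integralZl mu measurableT mHc (fun x _ => H0 (c * x)%R) cn0).
by rewrite (ge0_integral_dilate c0 mH H0) muleA -EFinM exprSr.
Qed.

Lemma ge0_integral_tuple_prod n (phi : 'I_n -> R -> R) :
  (forall i, measurable_fun [set: R] (phi i)) ->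
  (forall i x, (0 <= phi i x)%R) ->
  \int[lebesgue_tuple n]_t (\prod_(i < n) phi i (tnth t i))%:E =
  \prod_(i < n) \int[mu]_x (phi i x)%:E.
Proof.
elim: n phi => [|n IH] phi mphi phi0.
  rewrite big_ord0; under eq_integral do rewrite big_ord0.
  by rewrite integral_cst//= diracT mul1e.
have mprod m (psi : 'I_m -> R -> R) : (forall i, measurable_fun setT (psi i)) ->
    measurable_fun setT (fun t : m.-tuple R => (\prod_(i < m) psi i (tnth t i))%:E).
  move=> mpsi; apply/measurable_EFinP/measurable_prod => i _.
  by apply: measurableT_comp => //; exact: measurable_tnth.
have prod0 m (psi : 'I_m -> R -> R) (t : m.-tuple R) : (forall i x, 0 <= psi i x)%R ->
    0 <= (\prod_(i < m) psi i (tnth t i))%:E.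
  by move=> psi0; rewrite lee_fin prodr_ge0.
rewrite ge0_integral_lebesgue_tupleS//; [|exact: mprod|by move=> t; exact: prod0].
rewrite big_ord_recl -IH//.
transitivity (\int[mu]_x ((phi ord0 x)%:E *
  \int[lebesgue_tuple n]_t (\prod_(i < n) phi (lift ord0 i) (tnth t i))%:E)).
  apply: eq_integral => x _; rewrite -ge0_integralZl//.
  - apply: eq_integral => t _; rewrite -EFinM big_ord_recl; congr (_ * _)%:E.
    by apply: eq_bigr => i _; rewrite tnthS.
  - by apply: (mprod n (fun i => phi (lift ord0 i))) => i.
  - by move=> t _; apply: (prod0 _ (fun i => phi (lift ord0 i))).
  - by rewrite lee_fin.
rewrite ge0_integralZr//.
- by apply/measurable_EFinP; exact: (mphi ord0).
- by move=> x _; rewrite lee_fin.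
- by apply: integral_ge0 => t _; apply: (prod0 _ (fun i => phi (lift ord0 i))).
Qed.

End lebesgue_tuple_integral.

(** * The Dirichlet integral *)

Lemma powRD_gt0 {R : realType} (a r s : R) : 0 < a ->
  a `^ (r + s) = a `^ r * a `^ s.
Proof. by move=> a0; rewrite powRD// (gt_eqF a0) implybT. Qed.

Section gamma_kernel.
Context {R : realType}.
Local Notation mu := (@lebesgue_measure R).

(** The gamma density of shape [p] and rate [s] without its constant. The indicator is built in so
    that integrals run over the whole line and translations and dilations need no change of
    domain. *)
Definition gamma_kernel (p s x : R) : R :=
  \1_(`]0, +oo[%classic : set R) x * (x `^ (p - 1) * expR (- (s * x))).

Definition gamma_integral (p : R) : \bar R :=
  (\int[mu]_x (gamma_kernel p 1 x)%:E)%E.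

Lemma gamma_kernel_ge0 p s x : 0 <= gamma_kernel p s x.
Proof. by rewrite /gamma_kernel indicE !mulr_ge0 ?powR_ge0 ?expR_ge0. Qed.

Lemma gamma_kernel_gt0E p s x : 0 < x ->
  gamma_kernel p s x = x `^ (p - 1) * expR (- (s * x)).
Proof.
by move=> x0; rewrite /gamma_kernel indicE mem_set ?mul1r//= in_itv/= x0.
Qed.

Lemma gamma_kernel_le0E p s x : x <= 0 -> gamma_kernel p s x = 0.
Proof.
move=> x0; rewrite /gamma_kernel indicE memNset ?mul0r//= in_itv/= andbT.
by apply/negP; rewrite -leNgt.
Qed.

Lemma measurable_gamma_kernel d (T : measurableType d) p (s x : T -> R) :
  measurable_fun [set: T] s -> measurable_fun [set: T] x ->
  measurable_fun [set: T] (fun z => gamma_kernel p (s z) (x z)).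
Proof.
move=> ms mx; apply: measurable_funM.
  by apply: (measurableT_comp _ mx); exact: measurable_indic.
apply: measurable_funM; first exact: (measurableT_comp (@measurable_powR R _) mx).
apply: (measurableT_comp (@measurable_expR R)).
by apply: measurable_funN; exact: measurable_funM.
Qed.

Lemma GammaE p : Gamma p = fine (gamma_integral p).
Proof.
rewrite /Gamma /Rintegral /gamma_integral; congr fine.
rewrite integral_mkcond; apply: eq_integral => x _.
rewrite patchE; case: ifPn => [|/negP]; rewrite inE/= in_itv/= andbT => x0.
  by rewrite gamma_kernel_gt0E// mul1r.
by rewrite gamma_kernel_le0E// leNgt; apply/negP.
Qed.

Lemma gamma_integral_ge0 p : (0 <= gamma_integral p)%E.
Proof. by apply: integral_ge0 => x _; rewrite lee_fin gamma_kernel_ge0. Qed.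

(** The dilation x to s x. Both sides may be +oo. *)
Lemma integral_gamma_kernel (p s : R) : 0 < s ->
  (\int[mu]_x (gamma_kernel p s x)%:E = (s `^ (- p))%:E * gamma_integral p)%E.
Proof.
move=> s0; pose k1 x := (gamma_kernel p 1 x)%:E.
have mk1 : measurable_fun [set: R] k1.
  by apply/measurable_EFinP; exact: measurable_gamma_kernel.
have k10 x : (0 <= k1 x)%E by rewrite lee_fin gamma_kernel_ge0.
transitivity (\int[mu]_x ((s `^ (1 - p))%:E * k1 (s * x)%R))%E.
  apply: eq_integral => x _; rewrite -EFinM; congr EFin.
  have [x0|x0] := ltP 0 x; last first.
    by rewrite !gamma_kernel_le0E ?mulr0// pmulr_rle0.
  rewrite !gamma_kernel_gt0E ?mulr_gt0// mul1r powRM ?ltW// !mulrA -powRD_gt0//.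
  by rewrite addrA subrK subrr powRr0 mul1r.
have mk1s : measurable_fun [set: measurableTypeR R] (fun x => k1 (s * x)).
  by apply: (measurableT_comp mk1); exact: mulrl_measurable.
have c0 : (0 <= (s `^ (1 - p))%:E)%E by rewrite lee_fin powR_ge0.
rewrite (ge0_integralZl mu measurableT mk1s (fun x _ => k10 (s * x)) c0).
rewrite (ge0_integral_dilate s0 mk1 k10) muleA -EFinM; congr (_%:E * _)%E.
by rewrite -[s^-1]powR_inv1 ?ltW// -powRD_gt0// addrAC subrr sub0r.
Qed.

End gamma_kernel.

Section dirichlet_integral.
Context {R : realType}.
Local Notation mu := (@lebesgue_measure R).

Lemma measurable_open_simplex n : measurable (@open_simplex R n).
Proof.
rewrite (_ : @open_simplex R n =
    \bigcap_(i in [set: 'I_n]) ((fun x : n.-tuple R => tnth x i) @^-1` `]0, +oo[%classic)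
    `&` (fun x : n.-tuple R => \sum_(i < n) tnth x i) @^-1` `]-oo, 1[%classic).
  apply: measurableI.
    apply: fin_bigcap_measurable => // i _; rewrite -[X in measurable X]setTI.
    exact: measurable_tnth.
  rewrite -[X in measurable X]setTI.
  by apply: measurable_sum => // i; exact: measurable_tnth.
apply/seteqP; split=> [x [x0 x1]|x [x0 x1]]; split => /=.
- by move=> i _; rewrite /= in_itv/= x0.
- by rewrite in_itv.
- by move=> i; have := x0 i I; rewrite /= in_itv/= andbT.
- by move: x1; rewrite /= in_itv.
Qed.

Lemma measurable_complete_tuple n :
  measurable_fun [set: n.-tuple R] (@complete_tuple R n).
Proof.
apply: measurable_cons => //; apply: measurable_funB => //.
by apply: measurable_sum => i; exact: measurable_tnth.
Qed.

Lemma measurable_pairing n (f : 'rV[R]_n) :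
  measurable_fun [set: n.-tuple R] (pairing f).
Proof.
apply: measurable_sum => i; apply: measurable_funM => //.
exact: measurable_tnth.
Qed.

Definition dirichlet_weight n (a : 'rV[R]_n.+1) (x : n.-tuple R) : R :=
  \1_(@open_simplex R n) x * ((1 - \sum_(j < n) tnth x j) `^ (a ord0 ord0 - 1)
    * \prod_(j < n) tnth x j `^ (a ord0 (lift ord0 j) - 1)).

Lemma dirichlet_weight_ge0 n a x : 0 <= @dirichlet_weight n a x.
Proof.
rewrite /dirichlet_weight indicE !mulr_ge0 ?powR_ge0 ?prodr_ge0// => i _.
exact: powR_ge0.
Qed.

Lemma measurable_dirichlet_weight n (a : 'rV[R]_n.+1) :
  measurable_fun [set: n.-tuple R] (dirichlet_weight a).
Proof.
apply: measurable_funM; first by apply: measurable_indic; exact: measurable_open_simplex.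
apply: measurable_funM.
  apply: (measurableT_comp (@measurable_powR R _)); apply: measurable_funB => //.
  by apply: measurable_sum => i; exact: measurable_tnth.
apply: measurable_prod => i _; apply: (measurableT_comp (@measurable_powR R _)).
exact: measurable_tnth.
Qed.

Lemma pairing_complete_tuple n (f : 'rV[R]_n.+1) x :
  pairing f (complete_tuple x) = f ord0 ord0 * (1 - \sum_(j < n) tnth x j) +
    \sum_(j < n) f ord0 (lift ord0 j) * tnth x j.
Proof.
rewrite /pairing big_ord_recl; congr (_ * _ + _).
by apply: eq_bigr => i _; rewrite tnthS.
Qed.

(** The pointwise form of the substitution y = t x, with [t ^+ n] as Jacobian. The powers of t match
    because a - 1 = n + (a_0 - 1) + sum_j (a_j - 1). Off the open simplex one of the kernels on the
    right has a nonpositive argument, and both sides vanish. *)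
Lemma dirichlet_gamma_kernel n (a f : 'rV[R]_n.+1) (t : R) (x : n.-tuple R) :
  0 < t ->
  dirichlet_weight a x *
    gamma_kernel (\sum_i a ord0 i) (pairing f (complete_tuple x)) t =
  t ^+ n * (gamma_kernel (a ord0 ord0) (f ord0 ord0) (t - \sum_(j < n) t * tnth x j)
    * \prod_(j < n) gamma_kernel (a ord0 (lift ord0 j)) (f ord0 (lift ord0 j))
                                 (t * tnth x j)).
Proof.
move=> t0; rewrite -mulr_sumr -[X in X - t * _]mulr1 -mulrBr.
rewrite /dirichlet_weight indicE.
have [xS|xS] := boolP (x \in _); last first.
  rewrite !mul0r; move: xS; rewrite notin_setE => /= /not_andP[xS|/negP xS].
    have /existsNP[i /negP xi] := xS; rewrite -leNgt in xi.
    rewrite [X in _ * (_ * X)](bigD1 i)//=.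
    rewrite [gamma_kernel _ _ (t * tnth x i)]gamma_kernel_le0E.
      by rewrite mul0r !mulr0.
    by rewrite pmulr_rle0.
  rewrite [gamma_kernel _ _ (t * (1 - _))]gamma_kernel_le0E ?mul0r ?mulr0//.
  by rewrite pmulr_rle0// subr_le0 leNgt.
move: xS; rewrite inE => -[x0 x1]; rewrite mul1r gamma_kernel_gt0E//.
rewrite gamma_kernel_gt0E ?mulr_gt0 ?subr_gt0//.
rewrite [\prod_(j < n) gamma_kernel _ _ _](eq_bigr (fun j =>
    t `^ (a ord0 (lift ord0 j) - 1) * tnth x j `^ (a ord0 (lift ord0 j) - 1) *
    expR (- (f ord0 (lift ord0 j) * (t * tnth x j))))); last first.
  by move=> j _; rewrite gamma_kernel_gt0E ?mulr_gt0// powRM// ltW.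
rewrite !big_split/= powRM ?subr_ge0 ?ltW//.
have -> : \prod_(j < n) expR (- (f ord0 (lift ord0 j) * (t * tnth x j))) =
    expR (\sum_(j < n) - (f ord0 (lift ord0 j) * (t * tnth x j))).
  by rewrite expR_sum.
have -> : \prod_(j < n) t `^ (a ord0 (lift ord0 j) - 1) =
    t `^ (\sum_(j < n) (a ord0 (lift ord0 j) - 1)).
  elim/big_rec2: _ => [|i y1 y2 _ ->]; first by rewrite powRr0.
  by rewrite -powRD_gt0.
rewrite pairing_complete_tuple.
have -> : t `^ (\sum_i a ord0 i - 1) = t ^+ n * (t `^ (a ord0 ord0 - 1) *
   t `^ (\sum_(j < n) (a ord0 (lift ord0 j) - 1))).
  rewrite -powR_mulrn ?ltW// -!powRD_gt0//; congr powR.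
  by rewrite big_ord_recl sumrB sumr_const card_ord; ring.
have -> : - ((f ord0 ord0 * (1 - \sum_(j < n) tnth x j) +
    \sum_(j < n) f ord0 (lift ord0 j) * tnth x j) * t) =
   - (f ord0 ord0 * (t * (1 - \sum_(j < n) tnth x j))) +
   \sum_(j < n) - (f ord0 (lift ord0 j) * (t * tnth x j)).
  rewrite sumrN -opprD; congr (- _); rewrite mulrDl mulr_suml; congr (_ + _).
    by ring.
  by apply: eq_bigr => j _; ring.
rewrite expRD; ring.
Qed.

End dirichlet_integral.

Section dirichlet_integral_formula.
Local Open Scope ereal_scope.
Context {R : realType}.
Local Notation mu := (@lebesgue_measure R).

(** Tonelli is used twice. Integrated in t first, [W] gives the left-hand side. Integrated in x
    first, it has the same inner integrals as [G], by dilation by t. Integrating [G] in t first, the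
    translation by the sum of the x_j frees the kernel of a_0 from x and leaves a product of
    one-dimensional integrals. *)
Lemma dirichlet_integral n (a f : 'rV[R]_n.+1) : (forall i, 0 < f ord0 i)%R ->
  \int[lebesgue_tuple n]_x
    (dirichlet_weight a x *
     pairing f (complete_tuple x) `^ (- \sum_i a ord0 i))%:E *
    gamma_integral (\sum_i a ord0 i)%R =
  \prod_i ((f ord0 i `^ (- a ord0 i))%:E * gamma_integral (a ord0 i)).
Proof.
move=> f0; set A := (\sum_i a ord0 i)%R.
pose W (z : measurableTypeR R * n.-tuple R) := (dirichlet_weight a z.2 *
  gamma_kernel A (pairing f (complete_tuple z.2)) z.1)%:E.
pose K j := gamma_kernel (a ord0 (lift ord0 j)) (f ord0 (lift ord0 j)).
pose G (z : measurableTypeR R * n.-tuple R) :=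
  (gamma_kernel (a ord0 ord0) (f ord0 ord0) (z.1 - \sum_(j < n) tnth z.2 j) *
    \prod_(j < n) K j (tnth z.2 j))%:E.
have W0 z : 0 <= W z.
  by rewrite lee_fin mulr_ge0 ?dirichlet_weight_ge0 ?gamma_kernel_ge0.
have K0 j x : (0 <= K j x)%R by exact: gamma_kernel_ge0.
have G0 z : 0 <= G z.
  by rewrite lee_fin mulr_ge0 ?gamma_kernel_ge0// prodr_ge0.
have mW : measurable_fun setT W.
  apply/measurable_EFinP/measurable_funM.
    exact: (measurableT_comp (measurable_dirichlet_weight a) measurable_snd).
  apply: measurable_gamma_kernel; last exact: measurable_fst.
  apply: (measurableT_comp (measurable_pairing f)).
  exact: (measurableT_comp (@measurable_complete_tuple R n) measurable_snd).
have msum : measurable_fun [set: n.-tuple R] (fun x => \sum_(j < n) tnth x j)%R.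
  by apply: measurable_sum => j; exact: measurable_tnth.
have mKprod : measurable_fun [set: n.-tuple R]
    (fun x => \prod_(j < n) K j (tnth x j))%R.
  apply: measurable_prod => j _; apply: measurable_gamma_kernel => //.
  exact: measurable_tnth.
have mG : measurable_fun setT G.
  apply/measurable_EFinP/measurable_funM; last first.
    exact: (measurableT_comp mKprod measurable_snd).
  apply: measurable_gamma_kernel => //; apply: measurable_funB.
    exact: measurable_fst.
  exact: (measurableT_comp msum measurable_snd).
have WG t : \int[lebesgue_tuple n]_x W (t, x) = \int[lebesgue_tuple n]_x G (t, x).
  have mGt : measurable_fun [set: n.-tuple R] (fun x => G (t, x)).
    exact: (measurableT_comp mG (pair1_measurable t)).
  (* For t <= 0 both integrands vanish. In [G], either some x_j <= 0 kills its kernel, or all x_j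
     are positive and t minus their sum is nonpositive. *)
  have [t0|t0] := ltP 0%R t; last first.
    apply: eq_integral => x _; rewrite /W /G/= (gamma_kernel_le0E _ _ t0) mulr0.
    have [x0|] := pselect (forall j, 0 < tnth x j)%R.
      rewrite gamma_kernel_le0E ?mul0r// subr_le0 (le_trans t0)// sumr_ge0// => j _.
      exact: ltW.
    move=> /existsNP[j /negP]; rewrite -leNgt => xj.
    rewrite [X in _ = (_ * X)%:E](bigD1 j)//= (_ : K j (tnth x j) = 0%R) ?mul0r ?mulr0//.
    exact: gamma_kernel_le0E.
  transitivity (\int[lebesgue_tuple n]_x
      ((t ^+ n)%:E * G (t, [tuple of map ( *%R t) x]))).
    apply: eq_integral => x _; rewrite /W dirichlet_gamma_kernel//= -EFinM.
    congr (_ * (gamma_kernel _ _ (_ - _) * _))%:E; apply: eq_bigr => j _.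
      by rewrite tnth_map.
    by rewrite tnth_map.
  have mGd : measurable_fun [set: n.-tuple R]
      (fun x => G (t, [tuple of map ( *%R t) x])).
    apply: (measurableT_comp mGt); apply: measurable_map_tuple.
    exact: mulrl_measurable.
  have tn0 : 0 <= (t ^+ n)%:E by rewrite lee_fin exprn_ge0// ltW.
  rewrite (ge0_integralZl (lebesgue_tuple n) measurableT mGd (fun x _ => G0 _) tn0).
  rewrite (ge0_integral_tuple_dilate t0 mGt (fun x => G0 _)) muleA -EFinM.
  by rewrite -exprMn divff ?gt_eqF// expr1n mul1e.
have IA0 := gamma_integral_ge0 A.
transitivity (\int[lebesgue_tuple n]_x \int[mu]_t W (t, x)).
  have mq : measurable_fun [set: n.-tuple R] (fun x => (dirichlet_weight a x *
     pairing f (complete_tuple x) `^ (- A))%:E).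
    apply/measurable_EFinP/measurable_funM.
      exact: measurable_dirichlet_weight.
    apply: (measurableT_comp (@measurable_powR R _)).
    apply: (measurableT_comp (measurable_pairing f)).
    exact: measurable_complete_tuple.
  have q0 x : [set: n.-tuple R] x -> 0 <= (dirichlet_weight a x *
     pairing f (complete_tuple x) `^ (- A))%:E.
    by rewrite lee_fin mulr_ge0 ?dirichlet_weight_ge0 ?powR_ge0.
  rewrite -(ge0_integralZr (lebesgue_tuple n) measurableT mq q0 IA0).
  apply: eq_integral => x _.
  have mWx : measurable_fun [set: measurableTypeR R]
      (fun t => (gamma_kernel A (pairing f (complete_tuple x)) t)%:E).
    by apply/measurable_EFinP; exact: measurable_gamma_kernel.
  have dx0 : 0 <= (dirichlet_weight a x)%:E by rewrite lee_fin dirichlet_weight_ge0.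
  have kx0 t : [set: measurableTypeR R] t ->
      0 <= (gamma_kernel A (pairing f (complete_tuple x)) t)%:E.
    by rewrite lee_fin gamma_kernel_ge0.
  rewrite /W; under [RHS]eq_integral do rewrite EFinM.
  rewrite (ge0_integralZl mu measurableT mWx kx0 dx0) EFinM -muleA.
  (* The rate, a pairing with a completed tuple, is known to be positive only on the open simplex;
     elsewhere the weight is 0. *)
  have [xS|xS] := pselect (@open_simplex R n x); last first.
    by rewrite /dirichlet_weight indicE memNset// mul0r !mul0e.
  rewrite integral_gamma_kernel//; case: xS => x0 x1.
  rewrite pairing_complete_tuple ltr_pwDl ?mulr_gt0 ?subr_gt0// sumr_ge0// => j _.
  by rewrite mulr_ge0// ltW.
rewrite -(fubini_tonelli W mW W0); under eq_integral do rewrite WG.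
rewrite (fubini_tonelli G mG G0) big_ord_recl.
transitivity (\int[lebesgue_tuple n]_x ((\prod_(j < n) K j (tnth x j))%:E *
    ((f ord0 ord0 `^ (- a ord0 ord0))%:E * gamma_integral (a ord0 ord0)))).
  apply: eq_integral => x _; rewrite /G/=.
  have mk : measurable_fun [set: R]
      (fun t => (gamma_kernel (a ord0 ord0) (f ord0 ord0) t)%:E).
    by apply/measurable_EFinP; exact: measurable_gamma_kernel.
  have k0 t : 0 <= (gamma_kernel (a ord0 ord0) (f ord0 ord0) t)%:E.
    by rewrite lee_fin gamma_kernel_ge0.
  set s := (\sum_(j < n) tnth x j)%R.
  have mks : measurable_fun [set: measurableTypeR R]
      (fun t => (gamma_kernel (a ord0 ord0) (f ord0 ord0) (t - s))%:E).
    by apply: (measurableT_comp mk); exact: measurable_funB.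
  have p0 : 0 <= (\prod_(j < n) K j (tnth x j))%:E by rewrite lee_fin prodr_ge0.
  under eq_integral do rewrite mulrC EFinM.
  rewrite (ge0_integralZl mu measurableT mks (fun t _ => k0 (t - s)%R) p0).
  by rewrite (ge0_integral_shift s mk k0) integral_gamma_kernel.
have mKE : measurable_fun [set: n.-tuple R]
    (fun x => (\prod_(j < n) K j (tnth x j))%:E) by exact/measurable_EFinP.
have KE0 x : [set: n.-tuple R] x -> 0 <= (\prod_(j < n) K j (tnth x j))%:E.
  by rewrite lee_fin prodr_ge0.
have c0 : 0 <= (f ord0 ord0 `^ (- a ord0 ord0))%:E * gamma_integral (a ord0 ord0).
  by rewrite mule_ge0 ?gamma_integral_ge0// lee_fin powR_ge0.
rewrite (ge0_integralZr (lebesgue_tuple n) measurableT mKE KE0 c0) muleC.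
congr *%E; rewrite ge0_integral_tuple_prod//; last first.
  by move=> j; exact: measurable_gamma_kernel.
by apply: eq_bigr => j _; rewrite integral_gamma_kernel.
Qed.

End dirichlet_integral_formula.

(** * Expectations under Dirichlet and beta laws *)

Section dirichlet_law.
Local Open Scope ereal_scope.
Context {R : realType}.

Lemma dirichlet_weightE n (a : 'rV[R]_n.+1) (A : set (n.+1.-tuple R)) :
  dirichlet a A = \int[lebesgue_tuple n]_(x in complete_tuple (n:=n) @^-1` A)
    (Gamma (\sum_i a ord0 i) / \prod_i Gamma (a ord0 i) * dirichlet_weight a x)%:E.
Proof.
rewrite /dirichlet integral_mkcondl; apply: eq_integral => x _.
rewrite patchE /dirichlet_weight indicE; case: ifPn => xS; last first.
  by rewrite mul0r mulr0.
by rewrite /dirichlet_pdf mul1r mulrA.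
Qed.

Lemma Gamma_ge0 (p : R) : (0 <= Gamma p)%R.
Proof. by rewrite GammaE fine_ge0// gamma_integral_ge0. Qed.

(** [fine] sends infinite values to 0, so a nonzero [Gamma p] certifies that its integral is
    finite. *)
Lemma Gamma_neq0 (p : R) : Gamma p != 0%R -> gamma_integral p = (Gamma p)%:E.
Proof. by rewrite GammaE; case: (gamma_integral p); rewrite //= eqxx. Qed.

(* The law has total mass one, so that the normalising constant of its density is
   nonzero: all the Gamma integrals in it are therefore finite and nonzero. *)
Lemma dirichlet_law_integral n (a : 'rV[R]_n.+1) d (T : measurableType d)
    (P : probability T R) (X : {RV P >-> n.+1.-tuple R}) (f : 'rV[R]_n.+1) :
  has_law X (dirichlet a) -> (forall i, 0 < f ord0 i)%R ->
  \int[P]_w (pairing f (X w) `^ (- \sum_i a ord0 i))%:E =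
  (\prod_i f ord0 i `^ (- a ord0 i))%:E.
Proof.
move=> Xa f0; set s := (\sum_i a ord0 i)%R.
pose K := (Gamma s / \prod_i Gamma (a ord0 i))%R.
have K0 : (0 <= K)%R.
  by rewrite divr_ge0 ?Gamma_ge0// prodr_ge0// => i _; exact: Gamma_ge0.
have mw := measurable_dirichlet_weight a.
have transfer (h : 'rV[R]_n.+1) : \int[P]_w (pairing h (X w) `^ (- s))%:E =
    K%:E * \int[lebesgue_tuple n]_x
      (dirichlet_weight a x * pairing h (complete_tuple x) `^ (- s))%:E.
  have mp : measurable_fun [set: n.+1.-tuple R] (fun x => pairing h x `^ (- s))%R.
    exact: (measurableT_comp (@measurable_powR R _) (measurable_pairing h)).
  have mq : measurable_fun [set: n.-tuple R]
      (fun x => (dirichlet_weight a x * pairing h (complete_tuple x) `^ (- s))%:E).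
    apply/measurable_EFinP/measurable_funM => //.
    exact: (measurableT_comp mp (@measurable_complete_tuple R n)).
  have q0 x : [set: n.-tuple R] x ->
      0 <= (dirichlet_weight a x * pairing h (complete_tuple x) `^ (- s))%:E.
    by rewrite lee_fin mulr_ge0 ?dirichlet_weight_ge0 ?powR_ge0.
  have KE0 : 0 <= K%:E by rewrite lee_fin.
  rewrite -(ge0_integralZl (lebesgue_tuple n) measurableT mq q0 KE0).
  transitivity (\int[P]_w ((pairing h (X w) `^ (- s))%:E * (cst 1%R w)%:E)).
    by apply: eq_integral => w _; rewrite mule1.
  under [RHS]eq_integral => x _ do rewrite -EFinM mulrA mulrC EFinM.
  apply: (ge0_integral_transfer (phi1 := X) (p1 := cst 1%R)
    (phi2 := @complete_tuple R n) (p2 := fun x => (K * dirichlet_weight a x)%R)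
    (g := fun x => (pairing h x `^ (- s))%:E)) => //.
  - exact: measurable_complete_tuple.
  - exact: measurable_funM.
  - by move=> x; rewrite mulr_ge0// dirichlet_weight_ge0.
  - move=> A mA; rewrite -dirichlet_weightE -(Xa A mA)/= integral_cst//= ?mul1e//.
    by rewrite -[X in measurable X]setTI; exact: measurable_funPT.
  - exact/measurable_EFinP.
  - by move=> v; rewrite lee_fin powR_ge0.
have mwE : measurable_fun [set: n.-tuple R] (fun x => (dirichlet_weight a x)%:E).
  exact/measurable_EFinP.
have wE0 x : [set: n.-tuple R] x -> 0 <= (dirichlet_weight a x)%:E.
  by rewrite lee_fin dirichlet_weight_ge0.
have mass : K%:E * \int[lebesgue_tuple n]_x (dirichlet_weight a x)%:E = 1.
  have KE0 : 0 <= K%:E by rewrite lee_fin.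
  rewrite -(ge0_integralZl (lebesgue_tuple n) measurableT mwE wE0 KE0).
  have <- : distribution P X setT = 1 by exact: probability_setT.
  rewrite (Xa _ measurableT).
  rewrite dirichlet_weightE preimage_setT.
  by under [RHS]eq_integral do rewrite EFinM.
have K_neq0 : K != 0%R.
  by apply: contra_eq_neq mass => ->; rewrite mul0e eq_sym onee_eq0.
(* Since 0^-1 = 0, a nonzero quotient also has a nonzero denominator, hence every Gamma factor is
   nonzero. *)
move: (K_neq0); rewrite mulf_eq0 invr_eq0 negb_or => /andP[Gs0].
move=> /prodf_neq0 Ga0.
have pairing1 x : pairing (const_mx 1%R) (complete_tuple x : n.+1.-tuple R) = 1%R.
  rewrite pairing_complete_tuple !mxE mul1r.
  by under [X in (_ + X)%R]eq_bigr do rewrite mxE mul1r; rewrite subrK.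
have := dirichlet_integral a f0; rewrite -/s (Gamma_neq0 Gs0).
under [X in _ = X -> _]eq_bigr => i _ do rewrite (Gamma_neq0 (Ga0 i isT)) -EFinM.
rewrite transfer prodEFin big_split/= EFinM muleC.
set J := (\int[_]_x _) => GJ.
rewrite /K EFinM muleAC GJ -EFinM; congr EFin.
by rewrite mulfK//; apply/prodf_neq0.
Qed.

End dirichlet_law.

Lemma beta_pdfC {R : realType} (p q x : R) :
  Defs.beta_pdf p q x =
  Gamma (q + p) / (Gamma q * Gamma p) * ((1 - x) `^ (q - 1) * x `^ (p - 1)).
Proof.
have swap (u v w s t : R) : u / (v * w) * s * t = u / (w * v) * (t * s).
  by rewrite (mulrC v) -mulrA (mulrC s).
by rewrite /Defs.beta_pdf (addrC p); exact: swap.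
Qed.

(** Completing the 1-tuple Y gives (1 - Y, Y): Y sits at index 1, which is why the parameters of the
    beta law come in the order b_1, b_0. *)
Lemma beta_law_dirichlet {R : realType} d (T : measurableType d)
    (P : probability T R) (b : 'rV[R]_2) (Y : {RV P >-> R})
    (W : {RV P >-> 2.-tuple R}) :
  (forall w, W w = complete_tuple [tuple Y w]) ->
  has_law Y (beta_law (b ord0 ord_max) (b ord0 ord0)) -> has_law W (dirichlet b).
Proof.
move=> WY Yb A mA.
pose C (y : R) : 2.-tuple R := complete_tuple [tuple y].
have mC : measurable_fun [set: R] C.
  apply: (measurableT_comp (@measurable_complete_tuple R 1)).
  by apply: measurable_cons => //; exact: measurable_cst.
have mCA : measurable (C @^-1` A).
  by rewrite -[X in measurable X]setTI; exact: mC.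
transitivity (distribution P Y (C @^-1` A)).
  by rewrite /distribution /pushforward; congr (P _); apply/funext => w /=; rewrite WY.
rewrite (Yb _ mCA) /beta_law integral_mkcond dirichlet_weightE.
rewrite [RHS]integral_mkcond; set F := (_ \_ _ in RHS).
have mF : measurable_fun [set: 1.-tuple R] F.
  have mD : measurable (complete_tuple (n:=1) @^-1` A).
    by rewrite -[X in measurable X]setTI; exact: measurable_complete_tuple.
  apply/(measurable_restrictT _ mD).
  apply: measurable_funTS; apply/measurable_EFinP; apply: measurable_funM => //.
  exact: measurable_dirichlet_weight.
have F0 x : (0 <= F x)%E.
  rewrite /F patchE; case: ifP => // _.
  rewrite lee_fin mulr_ge0 ?dirichlet_weight_ge0// divr_ge0 ?Gamma_ge0//.
  by rewrite prodr_ge0// => i _; exact: Gamma_ge0.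
rewrite (ge0_integral_lebesgue_tupleS mF F0); apply: eq_integral => y _.
(* Lebesgue measure on 1-tuples is a product with the Dirac mass at the empty tuple, so the inner
   integral is a mere evaluation. *)
transitivity (F [tuple y]); last first.
  rewrite integral_dirac//; last first.
    apply: (measurableT_comp mF).
    exact: (measurableT_comp (@measurable_pair_cons R 0) (pair1_measurable y)).
  by rewrite /= diracT mul1e; congr F; exact: val_inj.
have sum1 : \sum_(j < 1) tnth [tuple y] j = y by rewrite big_ord1.
rewrite /F !patchE.
have [yA|yA] := boolP (_ \in complete_tuple (n:=1) @^-1` A); last first.
  rewrite memNset//; apply: contraNnot yA => -[_ yA].
  exact: mem_set.
have [y01|y01] := pselect (`]0, 1[%classic y); last first.
  rewrite memNset; last by move=> [].
  rewrite /dirichlet_weight indicE memNset ?mul0r ?mulr0// => -[y0].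
  rewrite sum1 => y1; apply: y01; rewrite /= in_itv/= y1 andbT.
  exact: (y0 ord0).
move: (y01); rewrite /= in_itv/= => /andP[y0 y1].
rewrite mem_set; last by split => //; move: yA; rewrite inE.
rewrite /dirichlet_weight indicE mem_set; last first.
  by split; [move=> i; rewrite ord1|rewrite sum1].
rewrite mul1r sum1 big_ord1 big_ord_recl big_ord1.
rewrite [X in _ = (_ / X * _)%:E]big_ord_recl big_ord1.
rewrite (_ : lift ord0 ord0 = ord_max); last exact: val_inj.
by congr EFin; exact: beta_pdfC.
Qed.

(** * Independence *)

Section independence.
Local Open Scope ereal_scope.
Context {R : realType} d (T : measurableType d) (P : probability T R).

(** All indices occur at once; events that involve only some of the variables are obtained by taking
    the other sides to be the whole space. *)
Definition independent_family n (G : 'I_n -> {RV P >-> R}) d' (V : measurableType d')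
    (W : {RV P >-> V}) :=
  forall (A : 'I_n -> set R) (B : set V),
  (forall i, measurable (A i)) -> measurable B ->
  P [set w | (forall i, A i (G i w)) /\ B (W w)] =
  (\prod_(i < n) P (G i @^-1` A i)) * P (W @^-1` B).

Context n (G : 'I_n -> {RV P >-> R}) d' (V : measurableType d') (W : {RV P >-> V}).
Hypothesis GW : independent_family G W.

Let mpreim d1 (U : measurableType d1) (X : {RV P >-> U}) A :
  measurable A -> measurable (X @^-1` A).
Proof.
by move=> mA; rewrite -[X in measurable X]setTI; exact: measurable_funPT.
Qed.

Lemma independent_family_fst (A : 'I_n -> set R) : (forall i, measurable (A i)) ->
  P [set w | forall i, A i (G i w)] = \prod_(i < n) P (G i @^-1` A i).
Proof.
move=> mA; have := GW mA measurableT.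
rewrite preimage_setT probability_setT mule1 => <-; congr (P _).
by apply/seteqP; split => [w h|w []].
Qed.

(** For fixed B, both sides are finite measures in A: the image of P restricted to the event W in B,
    and a multiple of the law of [GG]. They agree on boxes. *)
Lemma independent_family_tuple (GG : {RV P >-> n.-tuple R}) A B :
  (forall w i, tnth (GG w) i = G i w) -> measurable A -> measurable B ->
  P (GG @^-1` A `&` W @^-1` B) = P (GG @^-1` A) * P (W @^-1` B).
Proof.
move=> GGE mA mB; have mWB := mpreim W mB.
have PB0 : (0 <= fine (P (W @^-1` B)))%R by exact: fine_ge0.
have PBE : P (W @^-1` B) = (NngNum PB0)%:num%:E by rewrite /= fineK ?fin_num_measure.
pose m1 := pushforward (mrestr P mWB) GG.
pose m2 := mscale (NngNum PB0) (distribution P GG).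
have m2E S : m2 S = P (GG @^-1` S) * P (W @^-1` B) by rewrite PBE muleC.
suff : m1 A = m2 A by rewrite m2E.
apply: (measure_tuple_unique (G := measurable)) => //.
- by rewrite sigma_algebra_id//; exact: sigma_algebra_measurable.
- by move=> ? ? ? ?; exact: measurableI.
- rewrite /m1/= /pushforward/= preimage_setT /mrestr setTI -ge0_fin_numE//.
  exact: fin_num_measure.
move=> A0 mA0; rewrite [RHS]m2E.
have -> : GG @^-1` [set t | forall i, A0 i (tnth t i)] =
    [set w | forall i, A0 i (G i w)].
  by apply/seteqP; split=> w h i; move: (h i); rewrite /= GGE.
rewrite independent_family_fst// -GW//; congr (P _); apply/seteqP; split => w [h ?];
  by split => // i; move: (h i); rewrite GGE.
Qed.

(** Conditioning on [GG]: the joint law is the product of the marginals, and Tonelli puts the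
    integral over W inside, where the value of [GG] is frozen. *)
Lemma ge0_integral_independent_family (GG : {RV P >-> n.-tuple R})
    (k : n.-tuple R * V -> \bar R) :
  (forall w i, tnth (GG w) i = G i w) ->
  measurable_fun setT k -> (forall z, 0 <= k z) ->
  \int[P]_w k (GG w, W w) = \int[P]_w \int[P]_w' k (GG w, W w').
Proof.
move=> GGE mk k0.
have mGW : measurable_fun [set: T] (fun w => (GG w, W w)).
  by apply/measurable_fun_pairP; split; exact: measurable_funPT.
transitivity (\int[(distribution P GG \x distribution P W)%E]_z k z).
  rewrite -(ge0_integral_pushforward mGW P measurableT mk)//.
  apply: eq_measure_integral => A mA _; apply/esym.
  apply: product_measure_unique => // A1 A2 mA1 mA2.
  exact: independent_family_tuple.
rewrite (fubini_tonelli1 k mk k0).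
have mF := measurable_fun_fubini_tonelli_F (m2 := distribution P W) k mk k0.
rewrite (ge0_integral_distribution GG)//; last first.
  by move=> x; exact: integral_ge0.
apply: eq_integral => w _; rewrite /fubini_F/= (ge0_integral_distribution W)//.
exact: (measurableT_comp mk (pair1_measurable _)).
Qed.

Lemma ge0_integral_independent_prod (h : 'I_n -> R -> R) :
  (forall i, measurable_fun setT (h i)) -> (forall i x, 0 <= h i x)%R ->
  (forall i, \int[P]_w (h i (G i w))%:E < +oo) ->
  \int[P]_w (\prod_(i < n) h i (G i w))%:E =
  \prod_(i < n) \int[P]_w (h i (G i w))%:E.
Proof.
have int1 i (A : set R) : measurable A ->
    \int[P]_w (\1_A (G i w))%:E = P (G i @^-1` A).
  move=> mA; rewrite -(setIT (_ @^-1` _)) -(integral_indic P measurableT) ?setIT//.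
  exact: mpreim.
(* Outside [s] the factors are indicators; the induction is on [s]. *)
suff claim (s : seq 'I_n) (h' : 'I_n -> R -> R) :
    (forall i, measurable_fun setT (h' i)) -> (forall i x, 0 <= h' i x)%R ->
    (forall i, \int[P]_w (h' i (G i w))%:E < +oo) ->
    (forall i, i \notin s -> exists A, measurable A /\ h' i = \1_A) ->
    \int[P]_w (\prod_(i < n) h' i (G i w))%:E =
    \prod_(i < n) \int[P]_w (h' i (G i w))%:E.
  by move=> mh h0 hoo; apply: (claim (enum 'I_n)) => // i; rewrite mem_enum.
(* The factors are passed from indicators to general functions one at a time. *)
elim: s h' => [|i s IH] {}h mh h0 hoo hs.
  have /choice[A /all_and2[mA hA]] : forall i, exists A, measurable A /\ h i = \1_A.
    by move=> i; exact: hs.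
  transitivity (P [set w | forall i, A i (G i w)]); last first.
    rewrite independent_family_fst//; apply: eq_bigr => i _.
    by rewrite hA int1.
  have mE : measurable [set w | forall i, A i (G i w)].
    rewrite (_ : mkset _ = \bigcap_(i in [set: 'I_n]) (G i @^-1` A i)).
      by apply: fin_bigcap_measurable => // i _; exact: mpreim.
    by apply/seteqP; split => w hw i; [move=> _|]; exact: hw.
  rewrite -(setIT [set w | _]) -(integral_indic P measurableT mE).
  apply: eq_integral => w _; rewrite indicE; congr EFin.
  have [wE|wE] := pselect (forall i, A i (G i w)).
    rewrite mem_set// big1// => i _; rewrite hA indicE mem_set//.
  rewrite memNset//; move/existsNP : wE => [i wi].
  by rewrite (bigD1 i)//= hA indicE memNset// mul0r.
have [si|si] := boolP (i \in s).
  apply: IH => // j js; apply: hs; rewrite inE negb_or js andbT.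
  by apply: contraNneq js => ->.
pose c j := fine (\int[P]_w (h j (G j w))%:E).
have cE j : \int[P]_w (h j (G j w))%:E = (c j)%:E.
  rewrite fineK// ge0_fin_numE ?hoo// integral_ge0// => w _.
  by rewrite lee_fin.
have c0 j : (0 <= c j)%R.
  by rewrite fine_ge0// integral_ge0// => w _; rewrite lee_fin.
have cprod : \prod_(j < n | j != i) \int[P]_w (h j (G j w))%:E =
    (\prod_(j < n | j != i) c j)%:E.
  by rewrite -prodEFin; apply: eq_bigr => j _; rewrite cE.
pose psi w := (\prod_(j < n | j != i) h j (G j w))%R.
have mpsi : measurable_fun [set: T] psi.
  rewrite /psi; under eq_fun do rewrite -big_filter.
  apply: measurable_prod => j _.
  by apply: (measurableT_comp (mh j)); exact: measurable_funPT.
have mhi : measurable_fun setT (EFin \o h i) by exact/measurable_EFinP.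
under eq_integral do rewrite (bigD1 i)//= EFinM.
(* [h i] is integrated along [G i], once with density [psi] and once with the constant density that
   is to replace it. Equality of the two on an event [G i] in A is the induction hypothesis with
   [h i] replaced by the indicator of A. *)
transitivity (\int[P]_w ((h i (G i w))%:E * (\prod_(j < n | j != i) c j)%:E)).
  apply: (@ge0_integral_transfer R _ R _ _ T T P P (G i) (G i) psi
    (cst (\prod_(j < n | j != i) c j)%R) (EFin \o h i)) => //.
  - by move=> w; rewrite prodr_ge0.
  - by move=> w; rewrite prodr_ge0.
  - move=> A mA; have mGA := mpreim (G i) mA.
    transitivity ((\prod_(j < n | j != i) c j)%:E * P (G i @^-1` A)); last first.
      by rewrite -integral_cst.
    pose h1 j := if j == i then \1_A else h j.
    have h1i : h1 i = \1_A by rewrite /h1 eqxx.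
    have := IH h1; rewrite (bigD1 i)//= h1i int1//.
    rewrite (eq_bigr (fun j => \int[P]_w (h j (G j w))%:E)); last first.
      by move=> j /negbTE ji; rewrite /h1 ji.
    rewrite cprod muleC => <-.
    + rewrite integral_mkcond; apply: eq_integral => w _.
      rewrite (bigD1 i)//= /h1 eqxx patchE indicE.
      rewrite (eq_bigr (fun j => h j (G j w))); last by move=> j /negbTE ->.
      have [wA|wA] := boolP (w \in G i @^-1` A).
        by rewrite mem_set ?mul1r//; move: wA; rewrite inE.
      by rewrite memNset ?mul0r//; move: wA; rewrite notin_setE.
    + by move=> j; rewrite /h1; case: ifP.
    + by move=> j x; rewrite /h1; case: ifP => // _; rewrite indicE.
    + move=> j; rewrite /h1; case: ifP => // _.
      by rewrite int1// (le_lt_trans (probability_le1 _ _)) ?ltry//; exact: mpreim.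
    + move=> j js; rewrite /h1; case: ifPn => [_|ji]; first by exists A.
      by apply: hs; rewrite inE negb_or ji.
  - by move=> v; rewrite lee_fin.
rewrite ge0_integralZr//.
- by rewrite [RHS](bigD1 i)//= cprod.
- by apply: (measurableT_comp mhi); exact: measurable_funPT.
- by move=> w _; rewrite lee_fin.
- by rewrite lee_fin prodr_ge0.
Qed.

End independence.

(** * The T_c transform *)

Section T_transform_theory.
Context {R : realType}.

(** The witness is the inverse of the sum of the 1/f_i. It lies below every f_i, hence below their
    average with weights x_i. *)
Lemma pairing_lower_bound n (f : 'rV[R]_n.+1) : orthant n.+1 f ->
  exists2 m, 0 < m & forall x, simplex n.+1 x -> m <= pairing f x.
Proof.
move=> f0; pose s := \sum_(i < n.+1) (f ord0 i)^-1.
have s0 : 0 < s.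
  by rewrite /s big_ord_recl ltr_pwDl ?invr_gt0// sumr_ge0// => i _; rewrite invr_ge0 ltW.
exists s^-1; first by rewrite invr_gt0.
move=> x [x0 x1]; rewrite -[leLHS]mulr1 -x1 mulr_sumr ler_sum// => i _.
rewrite ler_wpM2r// -[leRHS]invrK lef_pV2 ?posrE ?invr_gt0//.
rewrite /s (bigD1 i)//= lerDl sumr_ge0// => j _.
by rewrite invr_ge0 ltW.
Qed.

Context d (T : measurableType d) (P : probability T R).

Lemma T_transformE c n (X : T -> n.-tuple R) f :
  T_transform P c X f = fine (\int[P]_w (pairing f (X w) `^ (- c))%:E)%E.
Proof. by rewrite /T_transform unlock. Qed.

Lemma measurable_pairing_powR n (f : 'rV[R]_n) (X : {RV P >-> n.-tuple R}) (c : R) :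
  measurable_fun [set: T] (fun w => pairing f (X w) `^ c).
Proof.
apply: (measurableT_comp (@measurable_powR R _)).
by apply: (measurableT_comp (measurable_pairing f)); exact: measurable_funPT.
Qed.

Lemma bounded_integrable (g : T -> R) (M : R) : measurable_fun setT g ->
  (forall w, `|g w| <= M) -> P.-integrable setT (EFin \o g).
Proof.
move=> mg gM; apply: (@le_integrable _ _ _ P setT measurableT _ (EFin \o cst M)).
- exact/measurable_EFinP.
- by move=> w _; rewrite /= lee_fin (le_trans (gM w))// ler_norm.
- exact: finite_measure_integrable_cst.
Qed.

Lemma powR_inv_le (m x c : R) : 0 < m -> m <= x -> 0 <= c ->
  x `^ (- c) <= m `^ (- c).
Proof.
move=> m0 mx c0; have x0 := lt_le_trans m0 mx.
by rewrite !powRN lef_pV2 ?posrE ?powR_gt0// ge0_ler_powR// nnegrE ltW.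
Qed.

Lemma T_transform_integrable n (f : 'rV[R]_n.+1) (X : {RV P >-> n.+1.-tuple R})
    (c : R) : orthant n.+1 f -> (forall w, simplex n.+1 (X w)) -> 0 <= c ->
  P.-integrable setT (fun w => (pairing f (X w) `^ (- c))%:E).
Proof.
move=> f0 XS c0; have [m m0 mP] := pairing_lower_bound f0.
apply: (@bounded_integrable _ (m `^ (- c))).
  exact: measurable_pairing_powR.
by move=> w; rewrite ger0_norm ?powR_ge0// powR_inv_le// mP.
Qed.

Lemma T_transform_EFin n (f : 'rV[R]_n.+1) (X : {RV P >-> n.+1.-tuple R})
    (c : R) : orthant n.+1 f -> (forall w, simplex n.+1 (X w)) -> 0 <= c ->
  (\int[P]_w (pairing f (X w) `^ (- c))%:E = (T_transform P c X f)%:E)%E.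
Proof.
move=> f0 XS c0; rewrite T_transformE fineK//.
by apply: integrable_fin_num => //; exact: T_transform_integrable.
Qed.

(** The uniform bound [m] has two uses: it makes (G_0 w, ..., G_n w) an admissible argument of the
    Dirichlet formula, and it bounds the negative powers of the G_i, whose expectations are
    therefore finite. *)
Lemma integral_dirichlet_mixture n (b : 'rV[R]_n.+1) (G : 'I_n.+1 -> {RV P >-> R})
    (W : {RV P >-> n.+1.-tuple R}) (m : R) :
  0 < m -> (forall i w, m <= G i w) -> (forall i, 0 < b ord0 i) ->
  independent_family G W -> has_law W (dirichlet b) ->
  (\int[P]_w ((\sum_i G i w * tnth (W w) i) `^ (- \sum_i b ord0 i))%:E =
   \prod_i \int[P]_w (G i w `^ (- b ord0 i))%:E)%E.
Proof.
move=> m0 mG b0 GW Wb; pose GG w := [tuple G i w | i < n.+1].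
have mGG : measurable_fun [set: T] GG.
  apply/measurable_fun_tnthP => i.
  rewrite (_ : _ \o _ = G i); last by apply/funext => w; rewrite /= tnth_mktuple.
  exact: measurable_funPT.
pose GGrv : {RV P >-> n.+1.-tuple R} := mfun_Sub (mem_set mGG).
pose k (z : n.+1.-tuple R * n.+1.-tuple R) :=
  ((\sum_i tnth z.1 i * tnth z.2 i) `^ (- \sum_i b ord0 i))%:E.
have mk : measurable_fun setT k.
  apply/measurable_EFinP; apply: (measurableT_comp (@measurable_powR R _)).
  apply: measurable_sum => i; apply: measurable_funM.
    exact: (measurableT_comp (measurable_tnth i) measurable_fst).
  exact: (measurableT_comp (measurable_tnth i) measurable_snd).
have k0 z : (0 <= k z)%E by rewrite lee_fin powR_ge0.
have GGE w i : tnth (GGrv w) i = G i w by rewrite tnth_mktuple.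
transitivity (\int[P]_w k (GGrv w, W w))%E.
  apply: eq_integral => w _; congr (_ `^ _)%:E.
  by apply: eq_bigr => i _; rewrite GGE.
rewrite (ge0_integral_independent_family GW GGE mk k0).
transitivity (\int[P]_w (\prod_i (G i w `^ (- b ord0 i)))%:E)%E.
  apply: eq_integral => w _.
  have f0 i : 0 < (\row_i G i w) ord0 i by rewrite mxE (lt_le_trans m0).
  have := dirichlet_law_integral Wb f0.
  under [X in _ = X%:E -> _]eq_bigr do rewrite mxE.
  move=> <-; apply: eq_integral => w' _; congr (_ `^ _)%:E.
  by apply: eq_bigr => i _; rewrite mxE GGE.
apply: (ge0_integral_independent_prod GW (h := fun i x => x `^ (- b ord0 i))) => //.
- by move=> i x; exact: powR_ge0.
move=> i; rewrite -ge0_fin_numE; last first.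
  by apply: integral_ge0 => w _; rewrite lee_fin powR_ge0.
apply: integrable_fin_num => //; apply: (@bounded_integrable _ (m `^ (- b ord0 i))).
  apply: (measurableT_comp (@measurable_powR R _)); exact: measurable_funPT.
by move=> w; rewrite ger0_norm ?powR_ge0// powR_inv_le// ltW.
Qed.

End T_transform_theory.

(** * Derivatives of the transform *)

Section T_transform_derivative.
Context {R : realType} d (T : measurableType d) (P : probability T R).

Lemma near_orthant n (f : 'rV[R]_n.+1) : orthant n.+1 f ->
  \forall g \near f, orthant n.+1 g.
Proof.
move=> f0.
apply: (@filter_forall _ _ (fun i (g : 'rV[R]_n.+1) => 0 < g ord0 i) (nbhs f)) => i.
by have /cvgr_gt := @coord_continuous R 1 n.+1 ord0 i f; apply; exact: f0.
Qed.

Lemma pairing_shift n (f : 'rV[R]_n.+1) (i : 'I_n.+1) (h : R) x :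
  pairing (h *: delta_mx ord0 i + f) x = pairing f x + h * tnth x i.
Proof.
rewrite /pairing; under eq_bigr do rewrite !mxE eqxx/= mulrDl.
rewrite big_split/= addrC; congr (_ + _); rewrite (bigD1 i)//= eqxx mulr1 big1 ?addr0//.
by move=> j /negbTE ji; rewrite ji mulr0 mul0r.
Qed.

Lemma simplex_le1 n (x : n.-tuple R) i : simplex n x -> 0 <= tnth x i <= 1.
Proof.
move=> [x0 x1]; rewrite x0/= -x1 (bigD1 i)//= lerDl sumr_ge0//.
Qed.

Context n (X : {RV P >-> n.+1.-tuple R}).
Hypothesis XS : forall w, simplex n.+1 (X w).

Definition partial_T_transform (c : R) (i : 'I_n.+1) (f : 'rV[R]_n.+1) : R :=
  \int[P]_w (tnth (X w) i * pairing f (X w) `^ (- (c + 1))).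

Lemma is_derive_T_transform (c : R) (f : 'rV[R]_n.+1) (i : 'I_n.+1) :
  0 < c -> orthant n.+1 f ->
  is_derive f (delta_mx ord0 i) (T_transform P c X)
    (- c * partial_T_transform c i f).
Proof.
move=> c0 f0; have [m m0 mP] := pairing_lower_bound f0.
(* The transform is followed along f + h e_i. As 0 <= X_i <= 1, taking h between -m/2 and m/2 keeps
   the pairing above m/2, so that the h-derivative is dominated by the constant c (m/2)^-(c+1). *)
pose phi h w := (pairing f (X w) + h * tnth (X w) i) `^ (- c).
have m20 : 0 < m / 2 by rewrite divr_gt0.
have XE h w : phi h w = pairing (h *: delta_mx ord0 i + f) (X w) `^ (- c).
  by rewrite pairing_shift.
have lb h w : `]- (m / 2), m / 2[%classic h ->
    m / 2 <= pairing f (X w) + h * tnth (X w) i.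
  rewrite /= in_itv/= => /andP[h1 h2]; have := mP _ (XS w).
  have /andP[x0 x1] := simplex_le1 i (XS w).
  have : - (m / 2) <= h * tnth (X w) i.
    have [h0|h0] := leP 0 h; first by rewrite (@le_trans _ _ 0) ?mulr_ge0// oppr_le0 ltW.
    by rewrite (le_trans (ltW h1))// ler_nMr.
  by move=> ? ?; rewrite [leLHS](_ : _ = m - m / 2) ?lerD//; field.
have mphi h : measurable_fun [set: T] (phi h).
  rewrite (_ : phi h = fun w => pairing (h *: delta_mx ord0 i + f) (X w) `^ (- c)).
    exact: measurable_pairing_powR.
  by apply/funext => w; exact: XE.
have dphi h w : `]- (m / 2), m / 2[%classic h ->
    is_derive h 1 (phi^~ w) (tnth (X w) i *
      (- c * (pairing f (X w) + h * tnth (X w) i) `^ (- c - 1))).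
  move=> hI; have lbh := lb _ w hI.
  have pos : 0 < pairing f (X w) + h * tnth (X w) i by exact: lt_le_trans lbh.
  have dl : is_derive h 1 (fun h => pairing f (X w) + h * tnth (X w) i) (tnth (X w) i).
    rewrite (_ : (fun _ => _) = cst (pairing f (X w)) + tnth (X w) i *: id); last first.
      by apply/funext => y; rewrite !fctE /= mulrC.
    apply: (is_derive_eq (is_deriveD (is_derive_cst _ h 1)
      (is_deriveZ _ (is_derive_id (h : R^o) 1)))).
    by rewrite add0r /GRing.scale/= mulr1.
  have dcomp := @is_derive1_comp R (fun y => y `^ (- c))
    (fun h => pairing f (X w) + h * tnth (X w) i) h _ _ (is_derive1_powR (- c) pos) dl.
  by apply: (is_derive_eq dcomp); rewrite mulrC.
have I0 : `]- (m / 2), m / 2[%classic (0 : R) by rewrite /= in_itv/= m20 oppr_lt0 m20.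
have int_phi h : `]- (m / 2), m / 2[%classic h ->
    P.-integrable setT (EFin \o phi h).
  move=> hI; apply: (@bounded_integrable _ _ _ _ _ ((m / 2) `^ (- c))) => // w.
  rewrite ger0_norm ?powR_ge0//; apply: powR_inv_le => //; first exact: lb.
  exact: ltW.
have dphiE h w : `]- (m / 2), m / 2[%classic h -> partial1of2 phi h w =
    tnth (X w) i * (- c * (pairing f (X w) + h * tnth (X w) i) `^ (- c - 1)).
  by move=> hI; rewrite partial1of2E; have := dphi _ w hI => -[].
have der x w : `]- (m / 2), m / 2[%classic x -> setT w -> derivable (phi^~ w) x 1.
  by move=> xI _; have := dphi _ w xI => -[].
have G0 (w : T) : 0 <= cst (c * (m / 2) `^ (- (c + 1))) w.
  by rewrite /= mulr_ge0 ?powR_ge0// ltW.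
have intG : P.-integrable setT (EFin \o cst (c * (m / 2) `^ (- (c + 1)))).
  exact: finite_measure_integrable_cst.
have G_ub x w : `]- (m / 2), m / 2[%classic x -> setT w ->
    `|partial1of2 phi x w| <= cst (c * (m / 2) `^ (- (c + 1))) w.
  move=> xI _; rewrite dphiE// /cst.
  have /andP[x0 x1] := simplex_le1 i (XS w).
  rewrite !normrM (ger0_norm x0) normrN (gtr0_norm c0) ger0_norm ?powR_ge0//.
  have c0' := ltW c0.
  rewrite -[leRHS]mul1r ler_pM ?mulr_ge0 ?powR_ge0//.
  rewrite ler_wpM2l// -opprD; apply: powR_inv_le => //; first exact: lb.
  by rewrite ltW// ltr_wpDr.
have := @cvg_differentiation_under_integral R _ T P phi setT measurableT 0
  (- (m / 2)) (m / 2) I0 int_phi der _ G0 intG G_ub.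
set l := (\int[P]_(y in setT) partial1of2 phi 0 y).
have -> : l = - c * partial_T_transform c i f.
  rewrite /l /partial_T_transform -RintegralZl//; last first.
    apply: (@bounded_integrable _ _ _ _ _ (m `^ (- (c + 1)))).
      apply: measurable_funM; last exact: measurable_pairing_powR.
      by apply: (measurableT_comp (measurable_tnth i)); exact: measurable_funPT.
    move=> w; have /andP[x0 x1] := simplex_le1 i (XS w).
    rewrite ger0_norm ?mulr_ge0 ?powR_ge0// -[leRHS]mul1r ler_pM ?powR_ge0//.
    by apply: powR_inv_le => //; [exact: mP|rewrite ltW// ltr_wpDr].
  apply: eq_Rintegral => w _; rewrite dphiE// mul0r addr0 opprD.
  by rewrite mulrCA.
move=> cvgF.
suff FE h : (T_transform P c X \o shift f) (h *: delta_mx ord0 i) = \int[P]_w phi h w.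
  have F0E : T_transform P c X f = \int[P]_w phi 0 w.
    by rewrite -FE /= scale0r add0r.
  have cvgD : h^-1 *: ((T_transform P c X \o shift f) (h *: delta_mx ord0 i) -
      T_transform P c X f) @[h --> 0^'] --> - c * partial_T_transform c i f.
    rewrite [X in X @ _ --> _](_ : _ = fun h =>
      h^-1 *: (\int[P]_w phi (h + 0) w - \int[P]_w phi 0 w))//.
    by apply/funext => h; rewrite FE F0E addr0.
  apply: DeriveDef; last exact: cvg_lim cvgD.
  by apply/cvg_ex; eexists; exact: cvgD.
rewrite [LHS]T_transformE; congr fine; apply: eq_integral => w _.
by rewrite XE.
Qed.

(** The coordinates of X sum to 1: this is why the sum of all partial derivatives, rather than a
    single one, leads back to the same family of transforms. *)
Lemma sum_partial_T_transform (c : R) (f : 'rV[R]_n.+1) : 0 < c -> orthant n.+1 f ->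
  \sum_i partial_T_transform c i f = T_transform P (c + 1) X f.
Proof.
move=> c0 f0; have [m m0 mP] := pairing_lower_bound f0.
have int_part i : P.-integrable setT
    (EFin \o fun w => tnth (X w) i * pairing f (X w) `^ (- (c + 1))).
  apply: (@bounded_integrable _ _ _ _ _ (m `^ (- (c + 1)))).
    apply: measurable_funM; last exact: measurable_pairing_powR.
    by apply: (measurableT_comp (measurable_tnth i)); exact: measurable_funPT.
  move=> w; have /andP[x0 x1] := simplex_le1 i (XS w).
  rewrite ger0_norm ?mulr_ge0 ?powR_ge0// -[leRHS]mul1r ler_pM ?powR_ge0//.
  by apply: powR_inv_le => //; [exact: mP|rewrite ltW// ltr_wpDr].
rewrite T_transformE /partial_T_transform /Rintegral sum_fine//; last first.
  by move=> i _; exact: (integrable_fin_num measurableT (int_part i)).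
congr fine; rewrite -integral_sum//; apply: eq_integral => w _.
rewrite sumEFin -mulr_suml.
by case: (XS w) => _ ->; rewrite mul1r.
Qed.

Lemma neg_sum_partial_T_transform (c : R) (f : 'rV[R]_n.+1) :
  0 < c -> orthant n.+1 f ->
  neg_sum_partial (T_transform P c X) f = c * T_transform P (c + 1) X f.
Proof.
move=> c0 f0; rewrite /neg_sum_partial -sum_partial_T_transform// mulr_sumr -sumrN.
apply: eq_bigr => i _; have [_ ->] := is_derive_T_transform i c0 f0.
by rewrite mulNr opprK.
Qed.

Lemma iter_neg_sum_partial_T_transform (c : R) k (f : 'rV[R]_n.+1) :
  0 < c -> orthant n.+1 f ->
  iter k neg_sum_partial (T_transform P c X) f =
  pochhammer c k * T_transform P (c + k%:R) X f.
Proof.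
move=> c0; elim: k f => [|k IH] f f0; first by rewrite addr0 mul1r.
have ck0 : 0 < c + k%:R by rewrite ltr_wpDr.
rewrite iterS (_ : c + k.+1%:R = c + k%:R + 1); last by rewrite -addrA natr1.
rewrite /= -mulrA -neg_sum_partial_T_transform// /neg_sum_partial mulrN.
congr (- _); rewrite mulr_sumr; apply: eq_bigr => i _.
have [der derE] := is_derive_T_transform i ck0 f0.
transitivity ('D_(delta_mx ord0 i)
    (pochhammer c k *: (T_transform P (c + k%:R) X : _ -> R^o)) f); last exact: deriveZ.
(* The induction hypothesis is an identity on the orthant only; since the orthant is open, it can be
   differentiated there. *)
apply: near_eq_derive.
by near=> g; rewrite IH//; near: g; exact: near_orthant.
Unshelve. all: by end_near. Qed.

(** A directional derivative has a value even where the defining limit fails to exist. This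
    certifies that the derivatives entering the iterates of H are genuine. *)
Lemma derivable_iter_neg_sum_partial_T_transform (c : R) k (i : 'I_n.+1)
    (f : 'rV[R]_n.+1) : 0 < c -> orthant n.+1 f ->
  derivable (iter k neg_sum_partial (T_transform P c X)) f (delta_mx ord0 i).
Proof.
move=> c0 f0; have ck0 : 0 < c + k%:R by rewrite ltr_wpDr.
have [der _] := is_derive_T_transform i ck0 f0.
have derZ : derivable
    (pochhammer c k \*: (T_transform P (c + k%:R) X : _ -> R^o)) f (delta_mx ord0 i).
  exact: derivableZ.
apply: (near_eq_derivable _ derZ).
near=> g; rewrite iter_neg_sum_partial_T_transform//.
by near: g; exact: near_orthant.
Unshelve. all: by end_near. Qed.

End T_transform_derivative.

(** * Bounded convergence and the mass of a face *)

Section bounded_convergence.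
Context {R : realType} d (T : measurableType d) (P : probability T R).

Lemma bounded_convergence (g_ : (T -> R)^nat) (g : T -> R) (M : R) :
  (forall n, measurable_fun setT (g_ n)) ->
  (forall n w, `|g_ n w| <= M) ->
  (forall w, g_ n w @[n --> \oo] --> g w) ->
  (\int[P]_w (g_ n w)%:E @[n --> \oo] --> \int[P]_w (g w)%:E)%E.
Proof.
move=> mg gM gg.
have gge w : ((g_ n w)%:E @[n --> \oo] --> (g w)%:E)%E.
  by apply: cvg_EFin; [exact: nearW|exact: gg].
apply: (@dominated_cvg _ T R P setT measurableT (fun n w => (g_ n w)%:E) _
  (EFin \o cst M)) => //.
- by move=> n; exact/measurable_EFinP.
- exact: finite_measure_integrable_cst.
- by move=> n w _; rewrite /= lee_fin.
Qed.

(** With S = X_0 + ... + X_k the pairing is t S + (1 - S). For t >= 1 it is at least 1, so its power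
    -c is at most 1; that power equals 1 where S = 0 and tends to 0 where S > 0. As the X_i are
    nonnegative, S = 0 means that each of them vanishes. *)
Lemma T_transform_cvg_mass n (X : {RV P >-> n.+1.-tuple R}) (c : R) (k : nat) :
  (forall w, simplex n.+1 (X w)) -> 0 < c ->
  (T_transform P c X (\row_(i < n.+1) (if (i <= k)%N then t else 1)))%:E
    @[t --> +oo] -->
  P [set w | forall i : 'I_n.+1, (i <= k)%N -> tnth (X w) i = 0].
Proof.
move=> XS c0; pose E := [set w | forall i : 'I_n.+1, (i <= k)%N -> tnth (X w) i = 0].
pose S w := \sum_(i < n.+1 | (i <= k)%N) tnth (X w) i.
have S0 w : 0 <= S w by apply: sumr_ge0 => i _; case: (XS w).
have S1 w : S w <= 1.
  case: (XS w) => x0 <-; rewrite [leRHS](bigID (fun i : 'I_n.+1 => (i <= k)%N))/=.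
  by rewrite lerDl sumr_ge0.
have SE w : S w = 0 <-> E w.
  split=> [/eqP|Ew]; last by apply: big1 => i; exact: Ew.
  rewrite psumr_eq0; last by move=> i _; case: (XS w).
  by move=> /allP h i ik; apply/eqP; move: (h i (mem_index_enum _)); rewrite ik.
have pairingE t w : pairing (\row_(i < n.+1) (if (i <= k)%N then t else 1)) (X w) =
    t * S w + (1 - S w).
  rewrite /pairing (bigID (fun i : 'I_n.+1 => (i <= k)%N))/=; congr (_ + _).
    by rewrite mulr_sumr; apply: eq_bigr => i ik; rewrite mxE ik.
  have [_ x1] := XS w; rewrite -[X in X - S w]x1.
  rewrite [X in X - _](bigID (fun i : 'I_n.+1 => (i <= k)%N))/=.
  rewrite addrC addrK; apply: eq_bigr => i /negbTE ik.
  by rewrite mxE ik mul1r.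
have mS : measurable_fun [set: T] S.
  rewrite (_ : S = fun w =>
      \sum_(i <- [seq i : 'I_n.+1 <- index_enum _ | (i <= k)%N]) tnth (X w) i).
    apply: measurable_sum => i.
    by apply: (measurableT_comp (measurable_tnth i)); exact: measurable_funPT.
  by apply/funext => w; rewrite big_filter.
have EE : E = S @^-1` [set 0] by apply/seteqP; split => w; rewrite /= SE.
have mE : measurable E by rewrite EE -[X in measurable X]setTI; exact: mS.
have -> : P E = (\int[P]_w (\1_E w)%:E)%E by rewrite integral_indic// setIT.
apply/cvge_pinftyP => u uoo.
have [N _ uN] : \forall n \near \oo, 1 <= u n by exact: cvgry_ge.
(* Dropping the first N terms gives [u] >= 1 throughout, hence the bound 1 at every index. *)
rewrite -(cvg_shiftn N).
have orth m : orthant n.+1 (\row_(i < n.+1) (if (i <= k)%N then u (m + N)%N else 1)).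
  move=> i; rewrite mxE; case: ifP => // _; rewrite (lt_le_trans ltr01)// uN//=.
  exact: leq_addl.
rewrite [X in X @ _ --> _](_ : _ =
    fun m => (\int[P]_w ((u (m + N)%N * S w + (1 - S w)) `^ (- c))%:E)%E); last first.
  apply/funext => m; rewrite /= -(T_transform_EFin (orth m) XS (ltW c0)).
  by apply: eq_integral => w _; rewrite pairingE.
apply: (@bounded_convergence _ _ 1).
- move=> m; apply: (measurableT_comp (@measurable_powR R _)).
  apply: measurable_funD; last exact: measurable_funB.
  exact: measurable_funM.
- have p1 : 1 `^ (- c) = 1 :> R by rewrite powR1.
  move=> m w; rewrite ger0_norm ?powR_ge0// -[leRHS]p1.
  apply: powR_inv_le => //; last exact: ltW.
  rewrite addrCA lerDl subr_ge0 ler_peMl// uN//=.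
  exact: leq_addl.
move=> w; have [Sw0|Sw0] := eqVneq (S w) 0.
  rewrite Sw0 indicE mem_set; last exact/SE.
  under eq_fun do rewrite mulr0 add0r subr0 powR1.
  exact: cvg_cst.
have Sgt0 : 0 < S w by rewrite lt_neqAle eq_sym Sw0 S0.
rewrite indicE memNset; last by move/SE/eqP; exact/negP.
apply/cvgr0Pnorm_le => e e0.
(* The decreasing map y to y^-c takes the value e at y = e^(-1/c). *)
have M0 : 0 < e `^ (- c^-1) by rewrite powR_gt0.
have [N' _ uN'] : \forall n \near \oo, e `^ (- c^-1) / S w <= u n by exact: cvgry_ge.
exists N' => // m /= N'm; rewrite ger0_norm ?powR_ge0//.
have -> : e = (e `^ (- c^-1)) `^ (- c).
  by rewrite -powRrM mulrNN mulVf ?gt_eqF// powRr1// ltW.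
apply: powR_inv_le => //; last exact: ltW.
rewrite (@le_trans _ _ (u (m + N)%N * S w))//.
  by rewrite -ler_pdivrMr// uN'//= (leq_trans N'm)// leq_addr.
by rewrite lerDl subr_ge0.
Qed.

End bounded_convergence.

(** * Uniqueness *)

Section exponential_limits.
Context {R : realType}.

Lemma cvg_divSn (s : R) : s / k.+1%:R @[k --> \oo] --> 0.
Proof. by rewrite -[X in _ --> X](mulr0 s); apply: cvgMr; exact: cvg_harmonic. Qed.

(** With x = s/(k+1), raise e^(x/(1+x)) <= 1 + x <= e^x to the power -(c+k+1), and drop the
    contribution of c from the upper bound. *)
Lemma cvg_powR_expR (c s : R) : 0 <= c -> 0 <= s ->
  (1 + s / k.+1%:R) `^ (- (c + k.+1%:R)) @[k --> \oo] --> expR (- s).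
Proof.
move=> c0 s0; have xcvg := cvg_divSn s.
apply: (@squeeze_cvgr _ _ _ _ (fun k => expR (- (s + c * (s / k.+1%:R))))
  (fun k => expR (- (s / (1 + s / k.+1%:R))))).
- apply: nearW => k; set x := s / k.+1%:R.
  have K0 : (0 : R) < k.+1%:R by rewrite ltr0n.
  have x0 : 0 <= x by rewrite divr_ge0// ltW.
  have x10 : 0 < 1 + x by rewrite ltr_pwDl.
  have sE : s = x * k.+1%:R by rewrite /x divfK// gt_eqF.
  have cK0 : 0 <= c + k.+1%:R by rewrite addr_ge0.
  apply/andP; split.
    have := powR_inv_le x10 (expR_ge1Dx x) cK0; rewrite -expRM; apply: le_trans.
    by rewrite ler_expR {1}sE mulrN lerN2 [c * x]mulrC mulrDr addrC.
  (* This is 1 + z <= e^z at z = -x/(1+x), where 1 + z = 1/(1+x). *)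
  have u1 : expR (x / (1 + x)) <= 1 + x.
    rewrite -lef_pV2 ?posrE ?expR_gt0// -expRN.
    rewrite [leLHS](_ : _ = 1 + - (x / (1 + x))); last by field; rewrite gt_eqF.
    exact: expR_ge1Dx.
  apply: (le_trans (powR_inv_le (expR_gt0 _) u1 cK0)).
  rewrite -expRM ler_expR mulrN lerN2 {1}sE mulrAC ler_wpM2l ?lerDr//.
  by rewrite divr_ge0// ltW.
- apply: (@cvg_comp _ _ _ _ expR _ (nbhs (- s))); last exact: continuous_expR.
  apply: cvgN; rewrite -[X in _ --> X]addr0 -(mulr0 c).
  by apply: cvgD; [exact: cvg_cst|exact: cvgMr].
- apply: (@cvg_comp _ _ _ _ expR _ (nbhs (- s))); last exact: continuous_expR.
  apply: cvgN; rewrite -[X in _ --> X](mulr1 s); apply: cvgMr.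
  have x1cvg : 1 + s / k.+1%:R @[k --> \oo] --> (1 : R).
    by rewrite -[X in _ --> X]addr0; apply: cvgD => //; exact: cvg_cst.
  have := cvgV (oner_neq0 R) x1cvg; rewrite invr1; exact.
Qed.

Lemma bernoulli_ge (y : R) n : 0 <= y <= 1 -> 1 - n%:R * y <= (1 - y) ^+ n.
Proof.
move=> /andP[y0 y1]; elim: n => [|n IH]; first by rewrite mul0r subr0 expr0.
have y1' : 0 <= 1 - y by rewrite subr_ge0.
rewrite exprS; apply: le_trans (ler_wpM2l y1' IH).
rewrite -subr_ge0 -natr1 [leRHS](_ : _ = n%:R * y ^+ 2); last by ring.
by rewrite mulr_ge0// sqr_ge0.
Qed.

(* With y = e^-x, the polynomials (1 - y^N)^K in y, K = floor (N e^(N b)), converge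
   on [0, 1] to the indicator of y < e^-b, that is of b < x. *)
Lemma cvg_expR_ray (b x : R) : 0 <= x ->
  (1 - expR (- (N.+1%:R * x))) ^+ (Num.truncn (N.+1%:R * expR (N.+1%:R * b)))
    @[N --> \oo] --> ((b < x)%R%:R : R).
Proof.
move=> x0; pose v N : R := N.+1%:R * expR (N.+1%:R * b).
pose y N : R := expR (- (N.+1%:R * x)).
have y01 N : 0 <= y N <= 1.
  by rewrite expR_ge0 -expR0 ler_expR oppr_le0 mulr_ge0.
have y1 N : 0 <= 1 - y N by rewrite subr_ge0; have /andP[] := y01 N.
have v0 N : 0 <= v N by rewrite mulr_ge0// expR_ge0.
(* The exponent is chosen for this product. Its exponential puts the threshold at b, and its factor
   N+1 makes the product at least N+1 for all x <= b, so that the limit is 0 at x = b too. *)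
have vyE N : v N * y N = N.+1%:R * expR (- (N.+1%:R * (x - b))).
  by rewrite /v /y -mulrA -expRD; congr (_ * expR _); ring.
have [bx|xb] := ltP b x; last first.
  (* The bound 1 - y <= e^-y gives at most e^-(K y) for the power. As K > v - 1 and y <= 1, K y >=
     N, and e^-N <= 1/(N+1). *)
  apply: (@squeeze_cvgr _ _ _ _ (cst 0) (fun N => 1 / N.+1%:R)).
  - apply: nearW => N; apply/andP; split; first exact: (exprn_ge0 _ (y1 N)).
    rewrite -/(y N) -/(v N) div1r.
    rewrite (@le_trans _ _ (expR (- N%:R)))//; last first.
      rewrite expRN lef_pV2 ?posrE ?expR_gt0 ?ltr0n//.
      by rewrite (le_trans _ (expR_ge1Dx _))// -nat1r.
    have : 1 - y N <= expR (- y N) by exact: expR_ge1Dx.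
    move=> /(lerXn2r (Num.truncn (v N)) (y1 N) (expR_ge0 _)) /le_trans; apply.
    rewrite -expRM_natl ler_expR mulrN lerN2.
    have /andP[_] := truncn_itv (v0 N); rewrite -natr1 -ltrBlDr => /ltW vK.
    have /andP[yN0 yN1] := y01 N.
    apply: le_trans (ler_wpM2r yN0 vK); rewrite mulrBl mul1r vyE.
    rewrite -natr1 -[leLHS](addrK 1) lerB// ler_peMr// -expR0 ler_expR.
    by rewrite oppr_ge0 mulr_ge0_le0// subr_le0.
  - exact: cvg_cst.
  - exact: cvg_divSn.
have d0 : 0 < x - b by rewrite subr_gt0.
(* Bernoulli gives at least 1 - K y for the power, and e^u >= u^2/2 at u = (N+1)(x-b) gives K y <= v
   y <= 2/((x-b)^2 (N+1)). *)
apply: (@squeeze_cvgr _ _ _ _ (fun N => 1 - 2 / (x - b) ^+ 2 / N.+1%:R) (cst 1)).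
- apply: nearW => N; rewrite -/(y N) -/(v N); apply/andP; split; last first.
    by rewrite exprn_ile1// lerBlDr lerDl; have /andP[] := y01 N.
  rewrite (le_trans _ (bernoulli_ge (Num.truncn (v N)) (y01 N)))//.
  rewrite lerB//; have /andP[vK _] := truncn_itv (v0 N).
  have /andP[yN0 yN1] := y01 N.
  apply: (le_trans (ler_wpM2r yN0 vK)); rewrite vyE expRN.
  have K0 : 0 < N.+1%:R * (x - b) by rewrite mulr_gt0.
  have e2 : (N.+1%:R * (x - b)) ^+ 2 / 2 <= expR (N.+1%:R * (x - b)).
    rewrite (le_trans _ (expR_ge1Dxn 1 (ltW K0)))// lerDr//.
  have K2 : 0 < (N.+1%:R * (x - b)) ^+ 2 / 2 by rewrite divr_gt0// exprn_gt0.
  rewrite [leRHS](_ : _ = N.+1%:R * ((N.+1%:R * (x - b)) ^+ 2 / 2)^-1).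
    by rewrite ler_wpM2l// lef_pV2 ?posrE ?expR_gt0.
  have Kn0 : N.+1%:R != 0 :> R by rewrite pnatr_eq0.
  have dn0 : x - b != 0 by rewrite gt_eqF.
  move: (N.+1%:R : R) (x - b) Kn0 dn0 => K D Kn0 dn0.
  by field; rewrite Kn0 dn0.
- rewrite -[X in _ --> X]subr0; apply: cvgB; first exact: cvg_cst.
  exact: cvg_divSn.
- exact: cvg_cst.
Qed.

End exponential_limits.

Lemma pochhammer_gt0 {R : realType} (c : R) k : 0 < c -> 0 < pochhammer c k.
Proof.
by move=> c0; elim: k => [|k IH] /=; rewrite ?ltr01// mulr_gt0// ltr_wpDr.
Qed.

Section uniqueness.
Context {R : realType} d d' (T : measurableType d) (T' : measurableType d')
  (P : probability T R) (P' : probability T' R) (n : nat).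
Variables (X : {RV P >-> n.+1.-tuple R}) (Z : {RV P' >-> n.+1.-tuple R}).
Hypotheses (XS : forall w, simplex n.+1 (X w)) (ZS : forall w, simplex n.+1 (Z w)).
Variable c : R.
Hypothesis c0 : 0 < c.
Hypothesis TXZ : forall f, orthant n.+1 f -> T_transform P c X f = T_transform P' c Z f.

(** The iterates of H at a point depend only on values near it, and the orthant is open; so the
    equality survives H^k, after which the positive factor (c)_k cancels. *)
Lemma T_transform_unique_shift k f : orthant n.+1 f ->
  T_transform P (c + k%:R) X f = T_transform P' (c + k%:R) Z f.
Proof.
move=> f0; apply: (mulfI (lt0r_neq0 (pochhammer_gt0 k c0))).
rewrite -!iter_neg_sum_partial_T_transform//.
elim: k f f0 => [|k IH] f f0; first exact: TXZ.
rewrite !iterS; congr (- _); apply: eq_bigr => i _.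
apply: near_eq_derive; near=> g; apply: IH.
by near: g; exact: near_orthant.
Unshelve. all: by end_near. Qed.

Definition exp_monomial (m : 'I_n.+1 -> nat) (x : n.+1.-tuple R) : R :=
  expR (- \sum_i (m i)%:R * tnth x i).

Lemma measurable_exp_monomial m : measurable_fun setT (exp_monomial m).
Proof.
apply: (measurableT_comp (@measurable_expR R)); apply: measurable_funN.
by apply: measurable_sum => i; apply: measurable_funM => //; exact: measurable_tnth.
Qed.

Lemma exp_monomial_itv m x : simplex n.+1 x -> 0 <= exp_monomial m x <= 1.
Proof.
move=> [x0 _]; rewrite expR_ge0 -expR0 ler_expR oppr_le0 sumr_ge0// => i _.
by rewrite mulr_ge0.
Qed.

(** On the simplex the pairing with 1 + m/(k+1) equals 1 + s/(k+1) with s = <m,X>. Its negative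
    powers are bounded by 1 and tend to e^-s. *)
Lemma integral_exp_monomial_lim m d1 (T1 : measurableType d1) (P1 : probability T1 R)
    (X1 : {RV P1 >-> n.+1.-tuple R}) : (forall w, simplex n.+1 (X1 w)) ->
  ((T_transform P1 (c + k.+1%:R) X1 (\row_i (1 + (m i)%:R / k.+1%:R)))%:E
     @[k --> \oo] --> \int[P1]_w (exp_monomial m (X1 w))%:E)%E.
Proof.
move=> X1S.
pose s w : R := \sum_i (m i)%:R * tnth (X1 w) i.
have s0 w : 0 <= s w.
  by apply: sumr_ge0 => i _; rewrite mulr_ge0//; case: (X1S w).
have pairingE k w : pairing (\row_i (1 + (m i)%:R / k.+1%:R)) (X1 w) = 1 + s w / k.+1%:R.
  have [_ x1] := X1S w; rewrite -[X in _ = X + _]x1 mulr_suml -big_split/=.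
  by apply: eq_bigr => i _; rewrite mxE mulrDl mul1r mulrAC.
have orth k : orthant n.+1 (\row_i (1 + (m i)%:R / k.+1%:R) : 'rV[R]_n.+1).
  by move=> i; rewrite mxE ltr_pwDl// divr_ge0.
have ck k : 0 <= c + k.+1%:R by rewrite addr_ge0// ltW.
rewrite [X in X @ _ --> _](_ : _ =
    fun k => (\int[P1]_w ((1 + s w / k.+1%:R) `^ (- (c + k.+1%:R)))%:E)%E); last first.
  apply/funext => k; rewrite -(T_transform_EFin (orth k) X1S (ck k)).
  by apply: eq_integral => w _; rewrite pairingE.
have ms : measurable_fun [set: T1] s.
  apply: measurable_sum => i; apply: measurable_funM => //.
  by apply: (measurableT_comp (measurable_tnth i)); exact: measurable_funPT.
apply: (@bounded_convergence _ _ _ _ _ _ 1).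
- move=> k; apply: (measurableT_comp (@measurable_powR R _)).
  by apply: measurable_funD => //; exact: measurable_funM.
- move=> k w; rewrite ger0_norm ?powR_ge0//.
  have p1 : 1 `^ (- (c + k.+1%:R)) = 1 :> R by rewrite powR1.
  by rewrite -[leRHS]p1 powR_inv_le// lerDl divr_ge0.
- by move=> w; apply: cvg_powR_expR => //; exact: ltW.
Qed.

Lemma integral_exp_monomial_unique m :
  (\int[P]_w (exp_monomial m (X w))%:E = \int[P']_w (exp_monomial m (Z w))%:E)%E.
Proof.
rewrite -(cvg_lim (@ereal_hausdorff R) (integral_exp_monomial_lim (m := m) XS)).
rewrite -(cvg_lim (@ereal_hausdorff R) (integral_exp_monomial_lim (m := m) ZS)).
apply: congr_lim; apply/funext => k; rewrite T_transform_unique_shift// => i.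
by rewrite mxE ltr_pwDl// divr_ge0.
Qed.

(* The test functions h that cannot distinguish X from Z, even when weighted by
   any product of the e^-x_i. *)
Definition indistinguishing (h : n.+1.-tuple R -> R) :=
  [/\ measurable_fun setT h, forall x, simplex n.+1 x -> 0 <= h x <= 1 &
   forall m, \int[P]_w (h (X w) * exp_monomial m (X w)) =
             \int[P']_w (h (Z w) * exp_monomial m (Z w))].

Lemma indistinguishing1 : indistinguishing (cst 1).
Proof.
split=> [|x _|m]; [by []|by rewrite ler01 lexx|].
rewrite /Rintegral.
by under eq_integral do rewrite mul1r;
   under [in RHS]eq_integral do rewrite mul1r; rewrite integral_exp_monomial_unique.
Qed.

Let integrable_test d1 (T1 : measurableType d1) (P1 : probability T1 R)
    (X1 : {RV P1 >-> n.+1.-tuple R}) (h : n.+1.-tuple R -> R) m :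
  (forall w, simplex n.+1 (X1 w)) ->
  measurable_fun setT h -> (forall x, simplex n.+1 x -> 0 <= h x <= 1) ->
  P1.-integrable setT (EFin \o (fun w => h (X1 w) * exp_monomial m (X1 w))).
Proof.
move=> X1S mh h01; apply: (@bounded_integrable _ _ _ _ _ 1).
  apply: measurable_funM.
    by apply: (measurableT_comp mh); exact: measurable_funPT.
  by apply: (measurableT_comp (measurable_exp_monomial m)); exact: measurable_funPT.
move=> w; have /andP[h0 h1] := h01 _ (X1S w).
have /andP[e0 e1] := exp_monomial_itv m (X1S w).
by rewrite ger0_norm ?mulr_ge0// -[leRHS]mul1r ler_pM.
Qed.

(** The factor e^-(N x_i) is absorbed by the monomial weight, whose i-th exponent grows by N. This
    is why [indistinguishing] ranges over all weights. *)
Lemma indistinguishingM h (N : nat) i : indistinguishing h ->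
  indistinguishing (fun x => h x * (1 - expR (- (N%:R * tnth x i)))).
Proof.
move=> [mh h01 hXZ]; split.
- apply: measurable_funM => //; apply: measurable_funB => //.
  apply: (measurableT_comp (@measurable_expR R)); apply: measurable_funN.
  by apply: measurable_funM => //; exact: measurable_tnth.
- move=> x xS; have /andP[h0 h1] := h01 x xS; have /andP[x0 x1] := simplex_le1 i xS.
  have e1 : expR (- (N%:R * tnth x i)) <= 1.
    by rewrite -[leRHS]expR0 ler_expR oppr_le0 mulr_ge0.
  rewrite mulr_ge0 ?subr_ge0//= -[leRHS]mul1r ler_pM ?subr_ge0//.
move=> m; pose m' j := (m j + (j == i) * N)%N.
have mm' x : h x * (1 - expR (- (N%:R * tnth x i))) * exp_monomial m x =
    h x * exp_monomial m x - h x * exp_monomial m' x.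
  rewrite -mulrA mulrBl mul1r mulrBr -expRD; congr (_ - _ * expR _).
  rewrite -opprD; congr (- _); rewrite /m'.
  under [RHS]eq_bigr do rewrite natrD mulrDl.
  rewrite big_split/= addrC; congr (_ + _).
  by rewrite (bigD1 i)//= eqxx mul1n big1 ?addr0// => j /negbTE ->; rewrite mul0n mul0r.
under eq_Rintegral do rewrite mm'.
under [RHS]eq_Rintegral do rewrite mm'.
by rewrite !RintegralB ?hXZ//; exact: integrable_test.
Qed.

Lemma indistinguishing_prod (N : nat) (K : 'I_n.+1 -> nat) :
  indistinguishing (fun x =>
    \prod_i (1 - expR (- (N%:R * tnth x i))) ^+ K i).
Proof.
suff step h i k : indistinguishing h ->
    indistinguishing (fun x => h x * (1 - expR (- (N%:R * tnth x i))) ^+ k).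
  elim: (index_enum _) => [|i s IH].
    rewrite (_ : (fun _ => _) = cst 1); first exact: indistinguishing1.
    by apply/funext => x; rewrite big_nil.
  rewrite (_ : (fun _ => _) = fun x =>
    (\prod_(j <- s) (1 - expR (- (N%:R * tnth x j))) ^+ K j) *
    (1 - expR (- (N%:R * tnth x i))) ^+ K i); first exact: step.
  by apply/funext => x; rewrite big_cons mulrC.
move=> hh; elim: k => [|k IH].
  by rewrite (_ : (fun _ => _) = h)//; apply/funext => x; rewrite expr0 mulr1.
rewrite (_ : (fun _ => _) = fun x =>
    h x * (1 - expR (- (N%:R * tnth x i))) ^+ k * (1 - expR (- (N%:R * tnth x i)))).
  exact: indistinguishingM.
by apply/funext => x; rewrite exprSr mulrA.
Qed.

Let exp_monomial0 x : exp_monomial (fun=> 0%N) x = 1.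
Proof.
by rewrite /exp_monomial big1 ?oppr0 ?expR0// => i _; rewrite mul0r.
Qed.

Lemma integral_rays_lim (b : 'I_n.+1 -> R) d1 (T1 : measurableType d1)
    (P1 : probability T1 R) (X1 : {RV P1 >-> n.+1.-tuple R}) :
  (forall w, simplex n.+1 (X1 w)) ->
  (\int[P1]_w (\prod_i (1 - expR (- (N.+1%:R * tnth (X1 w) i))) ^+
      Num.truncn (N.+1%:R * expR (N.+1%:R * b i)))%:E @[N --> \oo]
    --> P1 [set w | forall i, (b i < tnth (X1 w) i)%R])%E.
Proof.
move=> X1S; set E := [set w | _].
have mE : measurable E.
  rewrite (_ : E = \bigcap_(i in [set: 'I_n.+1])
      ((fun w => tnth (X1 w) i) @^-1` `]b i, +oo[%classic)).
    apply: fin_bigcap_measurable => // i _; rewrite -[X in measurable X]setTI.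
    apply: (measurableT_comp (measurable_tnth i)) => //; exact: measurable_funPT.
  apply/seteqP; split=> w Ew i; first by rewrite /= in_itv/= andbT => _; exact: Ew.
  by have := Ew i I; rewrite /= in_itv/= andbT.
have -> : P1 E = (\int[P1]_w (\1_E w)%:E)%E by rewrite integral_indic// setIT.
have x01 N w i : 0 <= 1 - expR (- (N.+1%:R * tnth (X1 w) i)) <= 1.
  have [x0 _] := X1S w; rewrite subr_ge0 lerBlDr lerDl expR_ge0 andbT.
  by rewrite -[leRHS]expR0 ler_expR oppr_le0 mulr_ge0.
apply: (@bounded_convergence _ _ _ _ _ _ 1).
- move=> N; apply: measurable_prod => i _; apply: measurable_funX.
  apply: measurable_funB => //; apply: (measurableT_comp (@measurable_expR R)).
  apply: measurable_funN; apply: measurable_funM => //.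
  by apply: (measurableT_comp (measurable_tnth i)); exact: measurable_funPT.
- move=> N w; rewrite ger0_norm; last first.
    by apply: prodr_ge0 => i _; have /andP[? _] := x01 N w i; exact: exprn_ge0.
  rewrite prodr_ile1// => i _; have /andP[? ?] := x01 N w i.
  by rewrite exprn_ge0//= exprn_ile1.
move=> w; have -> : \1_E w = \prod_i ((b i < tnth (X1 w) i)%R%:R : R).
  rewrite indicE; have [wE|wE] := pselect (E w).
    by rewrite mem_set// big1// => i _; rewrite wE.
  rewrite memNset//; move/existsNP : wE => [i /negP/negbTE wi].
  by rewrite (bigD1 i)//= wi mul0r.
apply: cvg_big => [|i _]; first exact: mul_continuous.
by apply: cvg_expR_ray; have [] := X1S w.
Qed.

Lemma T_transform_unique_rays (b : 'I_n.+1 -> R) :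
  P [set w | forall i, b i < tnth (X w) i] = P' [set w | forall i, b i < tnth (Z w) i].
Proof.
rewrite -(cvg_lim (@ereal_hausdorff R) (integral_rays_lim (b := b) XS)).
rewrite -(cvg_lim (@ereal_hausdorff R) (integral_rays_lim (b := b) ZS)).
apply: congr_lim; apply/funext => N.
pose h (x : n.+1.-tuple R) := \prod_i (1 - expR (- (N.+1%:R * tnth x i))) ^+
  Num.truncn (N.+1%:R * expR (N.+1%:R * b i)).
have [mh h01 hXZ] : indistinguishing h by exact: indistinguishing_prod.
have intX := integrable_test (fun=> 0%N) XS mh h01.
have intZ := integrable_test (fun=> 0%N) ZS mh h01.
have := congr1 EFin (hXZ (fun=> 0%N)); rewrite /Rintegral !fineK.
- under eq_integral do rewrite exp_monomial0 mulr1.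
  by under [X in _ = X -> _]eq_integral do rewrite exp_monomial0 mulr1.
- exact: (integrable_fin_num measurableT intZ).
- exact: (integrable_fin_num measurableT intX).
Qed.

Lemma T_transform_unique : eq_law X Z.
Proof.
pose G := [set A : set R | (exists b, A = `]b, +oo[%classic) \/ A = setT].
move=> A mA; apply: (measure_tuple_unique (G := G)
  (m1 := distribution P X) (m2 := distribution P' Z)) => //.
- apply/seteqP; split.
    have RE : (measurable : set (set R)) = <<s @RGenOInfty.G R >>.
      exact: RGenOInfty.measurableE.
    rewrite RE; apply: smallest_sub; first exact: smallest_sigma_algebra.
    by move=> _ [b ->]; apply: sub_sigma_algebra; left; exists b.
  apply: smallest_sub; first exact: sigma_algebra_measurable.
  by move=> B [[b ->]|->].
- move=> B B' [[b ->]|->] [[b' ->]|->].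
  + left; exists (Num.max b b'); apply/seteqP; split => x /=;
      by rewrite !in_itv/= !andbT gt_max => /andP.
  + by rewrite setIT; left; exists b.
  + by rewrite setTI; left; exists b'.
  + by rewrite setTI; right.
- by right.
- by rewrite /= (le_lt_trans (probability_le1 _ _))// ltry.
move=> B GB.
have /choice[b bB] : forall i, exists b, forall x, simplex n.+1 x ->
    (B i (tnth x i) <-> b < tnth x i).
  move=> i; case: (GB i) => [[b ->]|->].
    by exists b => x _; rewrite /= in_itv/= andbT.
  (* The side [setT] is not a ray, but coordinates on the simplex are nonnegative, so there it
     agrees with the ray above -1. *)
  by exists (-1) => x [x0 _]; split=> // _; rewrite (lt_le_trans _ (x0 i)).
transitivity (P [set w | forall i, b i < tnth (X w) i]).
  congr (P _).
  by apply/seteqP; split => w Bw i; apply/(bB i _ (XS w)); exact: Bw.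
rewrite T_transform_unique_rays; congr (P' _).
by apply/seteqP; split => w Bw i; apply/(bB i _ (ZS w)); exact: Bw.
Qed.

End uniqueness.

(** * Mixtures *)

Section mutual_independence.
Context {R : realType} d (T : measurableType d) (P : probability T R).

Lemma mutually_independent_option (I : finType) (S : option I -> set (set T))
    (E : I -> set T) (F : set T) :
  mutually_independent P S -> (forall i, S (Some i) (E i)) -> S None F ->
  (P [set w | (forall i, E i w) /\ F w] = (\prod_i P (E i)) * P F)%E.
Proof.
move=> indep SE SF.
have := indep finset.setT (fun o => if o is Some i then E i else F).
rewrite (bigD1 None) ?finset.in_setT//= (reindex_omap Some id); last first.
  by move=> [i|]//; rewrite eqxx andbF.
rewrite (eq_bigl predT); last by move=> i; rewrite finset.in_setT/= eqxx.
rewrite muleC => <-; last by move=> [i|] _ /=.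
congr (P _); apply/seteqP; split=> w.
  by move=> [Ew Fw] [i|] _ /=.
move=> h; split => [i|]; first by apply: (h (Some i)); rewrite /= finset.in_setT.
by apply: (h None); rewrite /= finset.in_setT.
Qed.

Lemma g_sigma_algebra_preimage_comp d1 d2 (U : measurableType d1)
    (V : measurableType d2) (X : T -> U) (g : U -> V) (A : set V) :
  measurable_fun setT g -> measurable A ->
  g_sigma_algebra_preimage X ((g \o X) @^-1` A).
Proof.
move=> mg mA; exists (g @^-1` A); last by rewrite setTI.
by rewrite -[X in measurable X]setTI; exact: mg.
Qed.

Definition pairing_rv n (f : 'rV[R]_n) (X : {RV P >-> n.-tuple R}) : {RV P >-> R} :=
  mfun_Sub (mem_set (measurableT_comp (measurable_pairing f) (measurable_funPT X))).

End mutual_independence.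

(** The mixture [V] enters only through its pairing with one fixed f, so that the general mixture
    and the two-term beta mixture are both instances. *)
Lemma T_transform_mixture {R : realType} d (T : measurableType d)
    (P : probability T R) n r (X : 'I_r.+1 -> {RV P >-> n.+1.-tuple R})
    (W : {RV P >-> r.+1.-tuple R}) (V : T -> n.+1.-tuple R) (b : 'rV[R]_r.+1)
    (f : 'rV[R]_n.+1) :
  orthant n.+1 f -> (forall i, 0 < b ord0 i) ->
  (forall i w, simplex n.+1 (X i w)) ->
  independent_family (fun i => pairing_rv f (X i)) W -> has_law W (dirichlet b) ->
  (forall w, pairing f (V w) = \sum_i pairing f (X i w) * tnth (W w) i) ->
  T_transform P (\sum_i b ord0 i) V f = \prod_i T_transform P (b ord0 i) (X i) f.
Proof.
move=> f0 b0 XS XW Wb VE; have [m m0 mP] := pairing_lower_bound f0.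
have mG i w : m <= pairing_rv f (X i) w by apply: mP; exact: XS.
rewrite T_transformE; apply: EFin_inj.
have E := integral_dirichlet_mixture m0 mG b0 XW Wb.
have -> : (\int[P]_w (pairing f (V w) `^ (- \sum_i b ord0 i))%:E =
    \prod_i (T_transform P (b ord0 i) (X i) f)%:E)%E.
  under eq_integral do rewrite VE.
  rewrite [LHS]E; apply: eq_bigr => i _.
  by rewrite -(T_transform_EFin f0 (XS i) (ltW (b0 i))).
by rewrite prodEFin.
Qed.

Lemma pairing_mixture {R : realType} n r (f : 'rV[R]_n) (x : 'I_r -> n.-tuple R)
    (y : 'I_r -> R) :
  pairing f [tuple \sum_i tnth (x i) j * y i | j < n] =
  \sum_i pairing f (x i) * y i.
Proof.
rewrite /pairing; under eq_bigr do rewrite tnth_mktuple mulr_sumr.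
rewrite exchange_big/=; apply: eq_bigr => i _.
by rewrite mulr_suml; apply: eq_bigr => j _; rewrite mulrA.
Qed.

Theorem theorem2p1 (R : realType) (d : nat) (hd : (1 <= d)%N) :
  (* 1 *)
  (forall (dT dT' : measure_display)
      (T : measurableType dT) (T' : measurableType dT')
      (P : probability T R) (P' : probability T' R)
      (X : {RV P >-> d.+1.-tuple R}) (Z : {RV P' >-> d.+1.-tuple R}),
    (forall w, simplex d.+1 (X w)) ->
    (forall w, simplex d.+1 (Z w)) ->
    (exists c : R, 0 < c /\
       forall f, orthant d.+1 f -> T_transform P c X f = T_transform P' c Z f) ->
    eq_law X Z) /\
  (* 2 *)
  (forall (dT : measure_display) (T : measurableType dT) (P : probability T R)
      (X : {RV P >-> d.+1.-tuple R}) (c : R) (k : nat),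
    (forall w, simplex d.+1 (X w)) -> 0 < c ->
    forall f, orthant d.+1 f ->
      (forall (j : nat) (i : 'I_d.+1), (j < k)%N ->
         derivable (iter j (@neg_sum_partial R d.+1) (T_transform P c X)) f
           (delta_mx ord0 i)) /\
      iter k (@neg_sum_partial R d.+1) (T_transform P c X) f =
        pochhammer c k * T_transform P (c + k%:R) X f) /\
  (* 3 *)
  (forall (dT : measure_display) (T : measurableType dT) (P : probability T R)
      (X : {RV P >-> d.+1.-tuple R}) (a : 'rV[R]_d.+1),
    orthant d.+1 a ->
    (forall w, simplex d.+1 (X w)) ->
    has_law X (dirichlet a) ->
    forall f, orthant d.+1 f ->
      T_transform P (\sum_i a ord0 i) X f =
        \prod_i (f ord0 i `^ (- a ord0 i))) /\
  (* 4 *)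
  (forall (r : nat) (dT : measure_display) (T : measurableType dT)
      (P : probability T R) (b : 'rV[R]_r.+1)
      (X : 'I_r.+1 -> {RV P >-> d.+1.-tuple R}) (Y : {RV P >-> r.+1.-tuple R}),
    (1 <= r)%N ->
    (forall i, 0 < b ord0 i) ->
    mutually_independent P (fun o : option 'I_r.+1 =>
      if o is Some i then g_sigma_algebra_preimage (X i)
      else g_sigma_algebra_preimage Y) ->
    (forall i w, simplex d.+1 (X i w)) ->
    (forall w, simplex r.+1 (Y w)) ->
    has_law Y (dirichlet b) ->
    forall f, orthant d.+1 f ->
      T_transform P (\sum_i b ord0 i)
        (fun w => [tuple \sum_(i < r.+1) tnth (X i w) j * tnth (Y w) i
                    | j < d.+1]) f =
        \prod_i T_transform P (b ord0 i) (X i) f) /\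
  (* 4, particular case *)
  (forall (dT : measure_display) (T : measurableType dT) (P : probability T R)
      (b0 b1 : R) (X0 X1 : {RV P >-> d.+1.-tuple R}) (Y : {RV P >-> R}),
    0 < b0 -> 0 < b1 ->
    mutually_independent P (fun o : option bool =>
      if o is Some i then g_sigma_algebra_preimage (if i then X1 else X0)
      else g_sigma_algebra_preimage Y) ->
    (forall w, simplex d.+1 (X0 w)) ->
    (forall w, simplex d.+1 (X1 w)) ->
    has_law Y (beta_law b1 b0) ->
    forall f, orthant d.+1 f ->
      T_transform P (b0 + b1)
        (fun w => [tuple (1 - Y w) * tnth (X0 w) j + Y w * tnth (X1 w) j
                    | j < d.+1]) f =
        T_transform P b0 X0 f * T_transform P b1 X1 f) /\
  (* 5 *)
  (forall (dT : measure_display) (T : measurableType dT) (P : probability T R)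
      (X : {RV P >-> d.+1.-tuple R}) (c : R) (k : nat),
    (forall w, simplex d.+1 (X w)) -> 0 < c -> (k <= d)%N ->
    (T_transform P c X (\row_(i < d.+1) (if (i <= k)%N then t else 1)))%:E
      @[t --> +oo] -->
    P [set w | forall i : 'I_d.+1, (i <= k)%N -> tnth (X w) i = 0]).
Proof.
split; [|split; [|split; [|split; [|split]]]].
- move=> dT dT' T T' P P' X Z XS ZS [c [c0 TXZ]].
  exact: (T_transform_unique XS ZS c0 TXZ).
- move=> dT T P X c k XS c0 f f0; split.
    by move=> j i _; exact: derivable_iter_neg_sum_partial_T_transform.
  exact: iter_neg_sum_partial_T_transform.
- move=> dT T P X a a0 XS Xa f f0.
  by rewrite T_transformE (dirichlet_law_integral Xa f0).
- move=> r dT T P b X Y r1 b0 indep XS YS Yb f f0.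
  apply: (T_transform_mixture f0 b0 XS _ Yb) => [A B mA mB|w]; last first.
    exact: pairing_mixture.
  apply: (mutually_independent_option indep) => [i|].
    exact: g_sigma_algebra_preimage_comp (measurable_pairing f) (mA i).
  by exists B => //; rewrite setTI.
- move=> dT T P b0 b1 X0 X1 Y b00 b10 indep X0S X1S Yb f f0.
  pose b : 'rV[R]_2 := \row_i (if i == ord0 then b0 else b1).
  pose X (i : 'I_2) := if i == ord0 then X0 else X1.
  have mC : measurable_fun [set: R] (fun y : R => complete_tuple [tuple y]).
    apply: (measurableT_comp (@measurable_complete_tuple R 1)).
    by apply: measurable_cons => //; exact: measurable_cst.
  pose W : {RV P >-> 2.-tuple R} :=
    mfun_Sub (mem_set (measurableT_comp mC (measurable_funPT Y))).
  have Wb : has_law W (dirichlet b).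
    by apply: (@beta_law_dirichlet _ _ _ _ _ Y) => //; rewrite !mxE.
  have XS i w : simplex d.+1 (X i w) by rewrite /X; case: ifP.
  have bgt0 i : 0 < b ord0 i by rewrite mxE; case: ifP.
  have -> : b0 + b1 = \sum_i b ord0 i by rewrite !big_ord_recl big_ord0 !mxE addr0.
  have -> : T_transform P b0 X0 f * T_transform P b1 X1 f =
      \prod_i T_transform P (b ord0 i) (X i) f.
    by rewrite !big_ord_recl big_ord0 !mxE mulr1.
  have W0 w : tnth (W w) ord0 = 1 - Y w.
    have sumY : \sum_(j < 1) tnth [tuple Y w] j = Y w by rewrite big_ord1.
    by rewrite -[X in _ = 1 - X]sumY.
  have W1 w : tnth (W w) (lift ord0 ord0) = Y w by [].
  apply: (T_transform_mixture f0 bgt0 XS _ Wb) => [A B mA mB|w]; last first.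
    rewrite -pairing_mixture; congr pairing; apply: eq_from_tnth => j.
    rewrite !tnth_mktuple !big_ord_recl big_ord0 addr0 W0 W1.
    by rewrite mulrC [X in _ + X = _]mulrC.
  (* The independence hypothesis is indexed by booleans and the mixture by two ordinals; [i_]
     matches [false] with X_0 and [true] with X_1. *)
  pose i_ (o : bool) : 'I_2 := if o then lift ord0 ord0 else ord0.
  have := mutually_independent_option
    (E := fun o => pairing_rv f (X (i_ o)) @^-1` A (i_ o)) (F := W @^-1` B) indep.
  rewrite big_bool/= !big_ord_recl big_ord0 mule1 [(P _ * P _)%E]muleC => <-.
  + congr (P _); apply/seteqP; split => w [Aw Bw]; split => //.
    move=> i; case: (unliftP ord0 i) => [j ->|->]; last exact: (Aw false).
    by rewrite (ord1 j); exact: (Aw true).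
  + by case; exact: g_sigma_algebra_preimage_comp (measurable_pairing f) (mA _).
  + exact: g_sigma_algebra_preimage_comp mC mB.
- move=> dT T P X c k XS c0 kd.
  exact: T_transform_cvg_mass.
Qed.
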